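(* For all integers $n \ge 2$ and $0 \le k \le n$ with $n-k$ even, there exists a CMDRR$(n,k)$, except for $(n,k) \in \{(2,2),(3,3),(4,2),(6,6)\}$ and possibly excepting the following 31 pairs: $(5,3)$, $(6,2)$, $(12,2)$, $(12,6)$, $(12,8)$, $(13,3)$, $(13,7)$, $(14,2)$, $(14,6)$, $(15,3)$, $(15,7)$, $(15,9)$, $(16,2)$, $(16,10)$, $(17,3)$, $(17,7)$, $(17,11)$, $(18,2)$, $(18,10)$, $(19,3)$, $(19,11)$, $(20,2)$, $(20,14)$, $(21,3)$, $(21,11)$, $(22,2)$, $(22,14)$, $(23,15)$, $(24,2)$, $(24,14)$, $(25,15)$.
   Context: A mixed doubles game is a match between two teams, each team consisting of one man and one woman; in a game $M_a F_b$ v $M_c F_d$, $M_a$ and $F_b$ are partners, $M_c$ and $F_d$ are partners, and each player of one team opposes each player of the other team. A complete mixed doubles round robin tournament CMDRR$(n,k)$ is a schedule (set) of mixed doubles games for $n$ men and $n$ women, of which $k$ men and $k$ women are paired into $k$ spouse pairs (a spouse pair is one man and one woman), such that: spouses never play in a game together as partners or opponents; every man and woman who are not spouses are partners exactly once and opponents exactly once; each player who has a spouse opposes every other player of the same sex exactly once; each player who does not have a spouse opposes some other same-sex player who does not have a spouse exactly twice and opposes all other same-sex players exactly once. *)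

(* Defs.v *)
From mathcomp Require Import all_boot.
Set Implicit Arguments. Unset Strict Implicit. Unset Printing Implicit Defensive.

(* Players: n men M_0..M_{n-1} and n women F_0..F_{n-1}, indexed by 'I_n.
   A game (a, b, c, d) is  M_a F_b  v  M_c F_d. *)
Record game (n : nat) := Game { gm1 : 'I_n; gf1 : 'I_n; gm2 : 'I_n; gf2 : 'I_n }.

Definition game_ok n (g : game n) := (gm1 g != gm2 g) && (gf1 g != gf2 g).

Definition partners n (m w : 'I_n) (g : game n) :=
  ((gm1 g == m) && (gf1 g == w)) || ((gm2 g == m) && (gf2 g == w)).
Definition opp_mw n (m w : 'I_n) (g : game n) :=
  ((gm1 g == m) && (gf2 g == w)) || ((gm2 g == m) && (gf1 g == w)).
Definition opp_mm n (m m' : 'I_n) (g : game n) :=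
  ((gm1 g == m) && (gm2 g == m')) || ((gm2 g == m) && (gm1 g == m')).
Definition opp_ww n (w w' : 'I_n) (g : game n) :=
  ((gf1 g == w) && (gf2 g == w')) || ((gf2 g == w) && (gf1 g == w')).

Definition spouse_matching n (P : {set 'I_n * 'I_n}) :=
  (forall p q, p \in P -> q \in P -> p.1 = q.1 -> p = q) /\
  (forall p q, p \in P -> q \in P -> p.2 = q.2 -> p = q).

Definition has_spouse_m n (P : {set 'I_n * 'I_n}) (m : 'I_n) :=
  exists w, (m, w) \in P.
Definition has_spouse_w n (P : {set 'I_n * 'I_n}) (w : 'I_n) :=
  exists m, (m, w) \in P.

Definition is_CMDRR n (P : {set 'I_n * 'I_n}) (S : seq (game n)) :=
  [/\ all (@game_ok n) S,
   (forall m w, (m, w) \in P ->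
      count (partners m w) S = 0 /\ count (opp_mw m w) S = 0),
   (forall m w, (m, w) \notin P ->
      count (partners m w) S = 1 /\ count (opp_mw m w) S = 1),
   (forall m, has_spouse_m P m ->
      forall m', m' != m -> count (opp_mm m m') S = 1) /\
   (forall w, has_spouse_w P w ->
      forall w', w' != w -> count (opp_ww w w') S = 1) &
   (forall m, ~ has_spouse_m P m ->
      exists m', [/\ m' != m, ~ has_spouse_m P m', count (opp_mm m m') S = 2 &
        forall m'', m'' != m -> m'' != m' -> count (opp_mm m m'') S = 1]) /\
   (forall w, ~ has_spouse_w P w ->
      exists w', [/\ w' != w, ~ has_spouse_w P w', count (opp_ww w w') S = 2 &
        forall w'', w'' != w -> w'' != w' -> count (opp_ww w w'') S = 1])].

Definition CMDRR_exists (n k : nat) :=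
  exists (P : {set 'I_n * 'I_n}) (S : seq (game n)),
    [/\ spouse_matching P, #|P| = k & is_CMDRR P S].

Definition definite_exceptions : seq (nat * nat) :=
  [:: (2,2); (3,3); (4,2); (6,6)].

Definition possible_exceptions : seq (nat * nat) :=
  [:: (5,3); (6,2); (12,2); (12,6); (12,8); (13,3); (13,7); (14,2); (14,6);
      (15,3); (15,7); (15,9); (16,2); (16,10); (17,3); (17,7); (17,11);
      (18,2); (18,10); (19,3); (19,11); (20,2); (20,14); (21,3); (21,11);
      (22,2); (22,14); (23,15); (24,2); (24,14); (25,15)].

(* Main.v *)
Require Import Defs.
From mathcomp Require Import all_boot.
From mathcomp Require Import zify.
Set Implicit Arguments. Unset Strict Implicit. Unset Printing Implicit Defensive.

(** Existence rests on holey schedules ("frames"): the players are split into holes, and every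
    incidence (partner, opponent of either sex) occurs once between different holes and never
    inside a hole.  Filling each hole with a CMDRR gives a CMDRR whose number of spouse pairs is
    the sum over the holes.  Wilson's fundamental construction produces frames from a
    transversal design by giving weights to its points, as soon as every block carries a frame
    whose hole sizes are the weights on it; weight 2 on most columns and weights at most 3 on
    the last one leave only the types 2^g v^1 with g = 4, 5, 6 and v <= 3 to be exhibited.  All
    orders n < 32 come from explicit CMDRRs and from frames a^m b^1 developed over the cyclic
    group Z_(am); the orders 32..110 from inflations of small designs, except that
    n = k = 34, 35, 38, 46 again use cyclic frames; and for n >= 111 one inflates the design
    with blocks (x, x+y, x+2y, x+3y, y) over Z_m, m coprime to 6, and concludes by strong
    induction.  Nonexistence in the four exceptional cases is an exhaustive search for pairwise
    compatible games, one for each encounter of two men. *)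

(** * Games over an arbitrary index type and their encounter counts *)

Definition quad (T : Type) := (T * T * T * T)%type.

Definition qmap (T U : Type) (f : T -> U) (g : quad T) : quad U :=
  let: (a, b, c, d) := g in (f a, f b, f c, f d).

Section Counts.
Variable T : eqType.
Implicit Types (x y : T) (g : quad T).

Definition prt x y g :=
  let: (a, b, c, d) := g in ((a == x) && (b == y)) || ((c == x) && (d == y)).
Definition opw x y g :=
  let: (a, b, c, d) := g in ((a == x) && (d == y)) || ((c == x) && (b == y)).
Definition omm x y g :=
  let: (a, b, c, d) := g in ((a == x) && (c == y)) || ((c == x) && (a == y)).
Definition oww x y g :=
  let: (a, b, c, d) := g in ((b == x) && (d == y)) || ((d == x) && (b == y)).

Definition counts (S : seq (quad T)) x y :=
  (count (prt x y) S, count (opw x y) S, count (omm x y) S, count (oww x y) S).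

(** One index type serves both sexes: [prt] and [opw] read [x] as a man and [y] as a woman, [omm]
    reads both as men, [oww] both as women. Thus [cw] prescribes the mixed encounters and [cs] those
    within one sex. *)
Definition sched S (cw cs : T -> T -> nat) :=
  forall x y, counts S x y = (cw x y, cw x y, cs x y, cs x y).

Lemma counts_cat S1 S2 x y :
  counts (S1 ++ S2) x y =
  (count (prt x y) S1 + count (prt x y) S2, count (opw x y) S1 + count (opw x y) S2,
   count (omm x y) S1 + count (omm x y) S2, count (oww x y) S1 + count (oww x y) S2).
Proof. by rewrite /counts !count_cat. Qed.

Lemma sched_cat S1 S2 cw1 cs1 cw2 cs2 :
  sched S1 cw1 cs1 -> sched S2 cw2 cs2 ->
  sched (S1 ++ S2) (fun x y => cw1 x y + cw2 x y) (fun x y => cs1 x y + cs2 x y).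
Proof.
move=> h1 h2 x y; have [] := h1 x y; have [] := h2 x y; rewrite counts_cat.
by move=> -> -> -> -> -> -> -> ->.
Qed.

Lemma sched_flatten (I : Type) (r : seq I) (S : I -> seq (quad T)) (cw cs : I -> T -> T -> nat) :
  (forall i, sched (S i) (cw i) (cs i)) ->
  sched (flatten (map S r)) (fun x y => \sum_(i <- r) cw i x y)
        (fun x y => \sum_(i <- r) cs i x y).
Proof.
move=> h; elim: r => [|i r IH] x y /=; first by rewrite !big_nil.
by rewrite (sched_cat (h i) IH) !big_cons.
Qed.

Lemma eq_sched S (cw cs cw' cs' : T -> T -> nat) :
  cw =2 cw' -> cs =2 cs' -> sched S cw cs -> sched S cw' cs'.
Proof. by move=> hw hs h x y; rewrite h hw hs. Qed.

End Counts.

(** * Transport of a schedule along an injection of players *)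

Section Image.
Variables (T U : finType) (f : T -> U).

Definition preimage_opt (x : U) : option T := [pick p | f p == x].

(** Extension by zero: players outside the image of [f] have no encounters. *)
Definition pull (c : T -> T -> nat) (x y : U) :=
  if preimage_opt x is Some p then
    if preimage_opt y is Some q then c p q else 0 else 0.

Hypothesis f_inj : injective f.

Lemma preimage_optK p : preimage_opt (f p) = Some p.
Proof.
rewrite /preimage_opt; case: pickP => [q /eqP/f_inj -> //|/(_ p)].
by rewrite eqxx.
Qed.

Lemma preimage_optN x : (forall p, f p != x) -> preimage_opt x = None.
Proof. by move=> h; rewrite /preimage_opt; case: pickP => // p; rewrite (negPf (h p)). Qed.

Lemma sched_map S cw cs :
  sched S cw cs -> sched (map (qmap f) S) (pull cw) (pull cs).
Proof.
move=> h x y; rewrite /counts !count_map /pull.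
have key P : (forall g, P g = false) -> count P S = 0.
  by move=> hP; rewrite (eq_count (a2 := pred0)) ?count_pred0.
have [p /eqP <-|hx] := pickP (fun p => f p == x); last first.
  rewrite preimage_optN => [|p]; last by rewrite hx.
  by congr (_, _, _, _); apply: key => -[[[a b] c] d] /=; rewrite !hx ?andbF.
have [q /eqP <-|hy] := pickP (fun p => f p == y); last first.
  rewrite preimage_optK preimage_optN => [|q]; last by rewrite hy.
  by congr (_, _, _, _); apply: key => -[[[a b] c] d] /=; rewrite !hy ?andbF.
rewrite !preimage_optK -[RHS]h; congr (_, _, _, _);
  by apply: eq_count => -[[[a b] c] d] /=; rewrite !(inj_eq f_inj).
Qed.

End Image.

(** * Holey schedules *)

Definition distinct_holes (T I : eqType) (h : T -> I) (x y : T) : nat := h x != h y.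

(** The diagonal lies inside a hole, so the man and the woman with the same index never meet in a
    frame. *)
Definition frame c (s : 'I_c -> nat) :=
  exists S : seq (quad {j : 'I_c & 'I_(s j)}), sched S (distinct_holes tag) (distinct_holes tag).

Lemma card_tagged_ord c (s : 'I_c -> nat) : #|{: {j : 'I_c & 'I_(s j)}}| = \sum_j s j.
Proof.
by rewrite card_tagged sumnE big_map big_enum; apply: eq_bigr => j _; rewrite card_ord.
Qed.

(** Only the sizes of the fibres of the hole map matter: a player is relabelled by its hole and its
    position in the enumeration of that hole. This is injective, and bijective by counting. *)
Lemma frame_intro (T : finType) c (h : T -> 'I_c) (s : 'I_c -> nat) S :
  sched S (distinct_holes h) (distinct_holes h) -> (forall j, #|[pred x | h x == j]| = s j) -> frame s.
Proof.
move=> hS hs.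
have lt x : index x (enum [pred y | h y == h x]) < s (h x).
  by rewrite -hs cardE index_mem mem_enum inE.
pose f x : {j : 'I_c & 'I_(s j)} := Tagged (fun j => 'I_(s j)) (Ordinal (lt x)).
have finj : injective f.
  move=> x y e; have et : h x = h y by have := congr1 (@tag _ _) e.
  have : index x (enum [pred z | h z == h x]) = index y (enum [pred z | h z == h y]).
    by have := congr1 (fun u : {j : 'I_c & 'I_(s j)} => nat_of_ord (tagged u)) e.
  by rewrite et; apply: (index_inj x); rewrite mem_enum inE /= ?et.
have cardT : #|T| = #|{: {j : 'I_c & 'I_(s j)}}|.
  rewrite card_tagged_ord -sum1_card (partition_big h xpredT) //=.
  by apply: eq_bigr => j _; rewrite -hs sum1_card; apply: eq_card => x; rewrite !inE.
have [g fK gK] : bijective f by apply: inj_card_bij => //; rewrite cardT.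
exists (map (qmap f) S) => x y; rewrite (sched_map finj hS) /pull.
by rewrite -(gK x) -(gK y) !preimage_optK.
Qed.

(** * Symmetric CMDRRs and the filling of holes *)

(* mu exchanges the mates (same-sex opponents met twice), with the same mu for men and women; its
   fixed points x stand for the spouse pairs (M_x, F_x). *)
Definition cmw (T : eqType) (mu : T -> T) (x y : T) : nat := ~~ ((x == y) && (mu x == x)).
Definition cms (T : eqType) (mu : T -> T) (x y : T) : nat := (x != y) + ((x != y) && (y == mu x)).

Definition CM_on (T : finType) k :=
  exists (mu : T -> T) (S : seq (quad T)),
    [/\ involutive mu, sched S (cmw mu) (cms mu) & #|[pred x | mu x == x]| = k].

Definition CM n k := CM_on 'I_n k.

(** The games are relabelled along a bijection and the mate involution is conjugated by it. *)
Lemma CM_transfer (T U : finType) k : #|T| = #|U| -> CM_on T k -> CM_on U k.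
Proof.
move=> e [mu [S [muK hS hk]]].
have [f [g fK gK]] : exists f : T -> U, bijective f.
  exists (fun x => enum_val (cast_ord e (enum_rank x))).
  exists (fun y => enum_val (cast_ord (esym e) (enum_rank y))) => x.
    by rewrite enum_valK cast_ordK enum_rankK.
  by rewrite enum_valK cast_ordKV enum_rankK.
exists (f \o mu \o g), (map (qmap f) S); split.
- by move=> y /=; rewrite fK muK gK.
- move=> x y; have finj := can_inj fK.
  rewrite (sched_map finj hS) /pull -(gK x) -(gK y) !(preimage_optK finj).
  by rewrite /cmw /cms /= !fK !(inj_eq (can_inj fK)).
- rewrite -hk -(card_image (can_inj fK) [pred x | mu x == x]); apply: eq_card => y.
  by rewrite -(gK y) (mem_image (can_inj fK)) !inE /= fK (inj_eq (can_inj fK)).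
Qed.

Lemma pull_tag c (s : 'I_c -> nat) (U : finType) (f : {j & 'I_(s j)} -> U)
    (r : U -> option 'I_c) x y :
  (forall z, omap tag (preimage_opt f z) = r z) ->
  pull f (distinct_holes tag) x y =
    if r x is Some i then if r y is Some j then (i != j : nat) else 0 else 0.
Proof. by move=> h; rewrite /pull -!h; case: preimage_opt => // p; case: preimage_opt. Qed.

(** Encounters between different holes come from the frame, those inside a hole from the schedule
    filling it. Mates stay inside their hole, so the fixed points of the combined involution, which
    are the spouse pairs, add up. *)
Theorem fill_holes c (s k : 'I_c -> nat) :
  frame s -> (forall j, CM (s j) (k j)) -> CM (\sum_j s j) (\sum_j k j).
Proof.
case=> S0 hS0 hCM.
have [mu hmu] := fin_all_exists hCM; have [S hS] := fin_all_exists hmu.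
pose T := {j : 'I_c & 'I_(s j)}.
pose f j (i : 'I_(s j)) : T := Tagged (fun j => 'I_(s j)) i.
have finj j : injective (f j) by move=> i i' e; apply: (eq_from_Tagged e).
apply: (@CM_transfer T); first by rewrite card_tagged_ord card_ord.
pose M (x : T) : T := f (tag x) (mu (tag x) (tagged x)).
exists M, (S0 ++ flatten [seq map (qmap (f j)) (S j) | j <- enum 'I_c]); split.
- by case=> j i; rewrite /M /f /=; have [-> _ _] := hS j.
- have hS1 j : sched (map (qmap (f j)) (S j)) (pull (f j) (cmw (mu j))) (pull (f j) (cms (mu j))).
    by have [_ h _] := hS j; exact: (sched_map (@finj j) h).
  (* In the sum over all holes only the hole of the first player contributes. *)
  have pullE (C : forall j, 'I_(s j) -> 'I_(s j) -> nat) j i (y : T) :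
      \sum_(l <- enum 'I_c) pull (f l) (C l) (f j i) y = pull (f j) (C j) (f j i) y.
    rewrite big_enum /= (bigD1 j) //= big1 ?addn0 // => l lj.
    rewrite /pull preimage_optN // => p; apply: contraNneq lj => e.
    by have := congr1 (@tag _ _) e => /= ->.
  have pullT (C : forall j, 'I_(s j) -> 'I_(s j) -> nat) j (i i' : 'I_(s j)) :
      pull (f j) (C j) (f j i) (f j i') = C j i i'.
    by rewrite /pull !(preimage_optK (@finj j)).
  have pullN (C : forall j, 'I_(s j) -> 'I_(s j) -> nat) j j' (i : 'I_(s j)) (i' : 'I_(s j')) :
      j != j' -> pull (f j) (C j) (f j i) (f j' i') = 0.
    move=> jj'; rewrite /pull (preimage_optK (@finj j)) preimage_optN // => p.
    by apply: contraNneq jj' => e; have := congr1 (@tag _ _) e => /= ->.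
  apply: eq_sched (sched_cat hS0 (sched_flatten _ hS1)) => -[j i] [j' i'];
    rewrite -[existT _ j i]/(f j i) -[existT _ j' i']/(f j' i') pullE /distinct_holes /=; have [e|ne] := eqVneq j j'.
  + case: j' / e i' => i'; rewrite -/(f j i') (pullT (fun j => cmw (mu j))).
    by rewrite /cmw /M /= !(inj_eq (@finj j)).
  + rewrite (pullN (fun j => cmw (mu j))) // /cmw; case: eqVneq => // e.
    by case/eqP: ne; have := congr1 (@tag _ _) e.
  + case: j' / e i' => i'; rewrite -/(f j i') (pullT (fun j => cms (mu j))).
    by rewrite /cms /M /= !(inj_eq (@finj j)).
  + rewrite (pullN (fun j => cms (mu j))) // /cms; have -> : f j i != f j' i'.
      by apply: contraNneq ne => e; have := congr1 (@tag _ _) e => /= ->.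
    case: (f j' i' =P M (f j i)) => // e; case/eqP: ne.
    by have := congr1 (@tag _ _) e; rewrite /M /= => ->.
- rewrite -sum1_card (eq_bigl (fun x : T => xpredT (tag x) && (mu (tag x) (tagged x) == tagged x))).
    rewrite -(sig_big_dep xpredT (fun j i => mu j i == i) (fun _ _ => 1)) /=.
    by apply: eq_bigr => j _; have [_ _ <-] := hS j; rewrite -sum1_card.
  by case=> j i; rewrite inE /M /= (inj_eq (finj j)).
Qed.

(** * Transversal designs and Wilson's fundamental construction *)

(** An orthogonal array: block [b] takes the point [B b j] from group [j]. There are as many blocks
    as pairs of points from two given groups, so injectivity says that each such pair lies in
    exactly one block. *)
Definition transversal_design c m (B : 'I_m * 'I_m -> 'I_c -> 'I_m) :=
  forall j j', j != j' -> injective (fun b => (B b j, B b j')).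

(** The point [x] of group [j] is replaced by [w j x] players and every block by a frame whose holes
    are its inflated points. Players of different groups meet only in the frame of the unique block
    through their points; players of one group never meet, since a block has a single point
    there. *)
Theorem inflate c m (B : 'I_m * 'I_m -> 'I_c -> 'I_m) (w : 'I_c -> 'I_m -> nat) :
  transversal_design B -> (forall b, frame (fun j => w j (B b j))) ->
  frame (fun j => \sum_x w j x).
Proof.
move=> hB hF; have [S hS] := fin_all_exists hF.
pose T := {p : 'I_c * 'I_m & 'I_(w p.1 p.2)}.
pose h (x : T) := (tag x).1.
pose f b (p : {j & 'I_(w j (B b j))}) : T :=
  existT (fun p => 'I_(w p.1 p.2)) (tag p, B b (tag p)) (tagged p).
have finj b : injective (f b).
  case=> j i [j' i'] e; have /= ej := congr1 (fun z : T => (tag z).1) e.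
  case: j' / ej i' e => i' e; congr existT.
  exact: (eq_from_Tagged (T_ := fun p : 'I_c * 'I_m => 'I_(w p.1 p.2)) e).
(* A player takes part in the frame of [b] exactly when its point lies on [b], and then in the hole
   given by its group. *)
have fpre b z : omap tag (preimage_opt (f b) z) =
    if B b (tag z).1 == (tag z).2 then Some (tag z).1 else None.
  case: z => -[j a] i /=; case: eqVneq => [e|ne].
    case: a / e i => i; have -> : existT _ (j, B b j) i = f b (existT _ j i) by [].
    by rewrite (preimage_optK (@finj b)).
  rewrite preimage_optN // => -[j' i']; apply: contraNneq ne => e.
  by have /= [-> ->] := congr1 (@tag _ _) e.
have := @sched_flatten _ _ (enum {: 'I_m * 'I_m}) _ _ _ (fun b => sched_map (@finj b) (hS b)).
set S' := flatten _ => hS'.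
apply: (@frame_intro _ _ h _ S') => [x y|j].
  have -> : distinct_holes h x y = \sum_(b <- enum {: 'I_m * 'I_m}) pull (f b) (distinct_holes tag) x y.
    rewrite big_enum /=.
    under eq_bigr => b _ do rewrite (pull_tag _ _ (fpre b)).
    rewrite /distinct_holes /h; case: x y => -[j a] i [[j' a'] i'] /=; case: eqVneq => [->|ne].
      by rewrite big1 // => b _; do 2!case: ifP => // _; rewrite eqxx.
    (* An injective self-map of a finite set is bijective; [g] returns the block through two given
       points. *)
    have [g gK Kg] := injF_bij (hB _ _ ne).
    rewrite (bigD1 (g (a, a'))) //= big1 => [|b nb].
      by have := Kg (a, a'); case=> -> ->; rewrite !eqxx ne.
    do 2!case: ifP => //; move=> /eqP e' /eqP e; case/eqP: nb.
    by rewrite -(gK b) /= e e'.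
  exact: hS'.
rewrite -sum1_card (eq_bigl (fun x : T => ((tag x).1 == j) && xpredT (tagged x))); last first.
  by move=> x; rewrite inE andbT.
rewrite -(sig_big_dep (fun p : 'I_c * 'I_m => p.1 == j) (fun _ => xpredT) (fun _ _ => 1)) /=.
under eq_bigr => p _ do rewrite sum1_card card_ord.
rewrite (eq_bigl (fun p : 'I_c * 'I_m => (p.1 == j) && xpredT p.2)); last first.
  by move=> p; rewrite andbT.
rewrite -(pair_big_dep (fun j' => j' == j) (fun _ => xpredT) (fun j a => w j a)) /=.
by rewrite big_pred1_eq.
Qed.

(** * Schedules on natural numbers, verified by computation *)

Section NatCheck.
Variable n : nat.
Implicit Types (S : seq (quad nat)) (x y : nat).

Definition qbelow (g : quad nat) := let: (a, b, c, d) := g in [&& a < n, b < n, c < n & d < n].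

(** The second index runs over all players but the first only over [xs], which can be a set of orbit
    representatives. *)
Definition check S (xs : seq nat) (cw cs : nat -> nat -> nat) :=
  all qbelow S &&
  all (fun x => all (fun y => counts S x y == (cw x y, cw x y, cs x y, cs x y)) (iota 0 n)) xs.

End NatCheck.

Lemma counts_inord n S (x y : 'I_n.+1) :
  all (qbelow n.+1) S -> counts (map (qmap (@inord n)) S) x y = counts S x y.
Proof.
move=> /allP hS; rewrite /counts !count_map.
have e a (z : 'I_n.+1) : a < n.+1 -> (inord a == z) = (a == z :> nat).
  by move=> la; rewrite -val_eqE /= inordK.
by congr (_, _, _, _); apply: eq_in_count => -[[[a b] c] d] /hS /and4P [ha hb hc hd] /=; rewrite !e.
Qed.

Definition nat_sched n S (cw cs : nat -> nat -> nat) :=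
  all (qbelow n) S /\
  (forall x y, x < n -> y < n -> counts S x y = (cw x y, cw x y, cs x y, cs x y)).

Lemma sched_of_nat n S cw cs : nat_sched n S cw cs ->
  exists S' : seq (quad 'I_n), sched S' (fun x y => cw x y) (fun x y => cs x y).
Proof.
case: n => [|n] [hb hc]; first by exists [::] => -[].
by exists (map (qmap (@inord n)) S) => x y; rewrite counts_inord ?hc.
Qed.

Lemma check_full n S cw cs : check n S (iota 0 n) cw cs -> nat_sched n S cw cs.
Proof.
case/andP=> hb /allP hc; split=> // x y hx hy.
have mem z : z < n -> z \in iota 0 n by rewrite mem_iota.
exact: eqP (allP (hc x (mem x hx)) y (mem y hy)).
Qed.

(** * Developing base games under a permutation *)

Section Development.
Variables (n k : nat) (sigma : nat -> nat) (base : seq (quad nat)).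

Definition develop := flatten [seq map (qmap (iter i sigma)) base | i <- iota 0 k].

Definition check_dev (R : seq nat) cw cs :=
  [&& 0 < k, all (fun x => (sigma x < n) && (iter k sigma x == x)) (iota 0 n),
   all (fun r => r < n) R,
   all (fun x => has (fun r => x \in traject sigma r k) R) (iota 0 n) &
   check n develop R cw cs].

Hypothesis sigma_lt : forall x, x < n -> sigma x < n.
Hypothesis sigma_k : forall x, x < n -> iter k sigma x = x.

Let iter_lt i x : x < n -> iter i sigma x < n.
Proof. by elim: i => //= i IH /IH /sigma_lt. Qed.

Lemma sigma_inj x y : 0 < k -> x < n -> y < n -> sigma x = sigma y -> x = y.
Proof.
move=> k0 hx hy e; rewrite -(sigma_k hx) -(sigma_k hy).
by rewrite -(prednK k0) !iterSr e.
Qed.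

(** Applying [sigma] moves each translate of the base to the next one, and the last one back to the
    base because the [k]-th power of [sigma] is the identity on players. *)
Lemma perm_develop : 0 < k -> all (qbelow n) base ->
  perm_eq (map (qmap sigma) develop) develop.
Proof.
move=> k0 hb; rewrite /develop map_flatten -map_comp.
rewrite (eq_map (g := fun i => map (qmap (iter i.+1 sigma)) base)); last first.
  by move=> i /=; rewrite -map_comp; apply: eq_map => -[[[a b] c] d].
have -> : [seq map (qmap (iter i.+1 sigma)) base | i <- iota 0 k] =
    [seq map (qmap (iter i sigma)) base | i <- iota 1 k].
  by rewrite -add1n iotaDl -map_comp.
have [k' ek] : exists k', k = k'.+1 by exists k.-1; rewrite prednK.
have -> : iota 1 k = iota 1 k' ++ [:: k] by rewrite ek -(addn1 k') iotaD add1n addn1.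
rewrite {2}ek map_cat flatten_cat /= cats0 perm_catC perm_cat //.
have -> // : map (qmap (iter k sigma)) base = map (qmap id) base.
apply/eq_in_map => -[[[a b] c] d] /(allP hb) /and4P [ha hb' hc hd].
by rewrite /= !sigma_k.
Qed.

Lemma counts_sigma x y : 0 < k -> all (qbelow n) base -> x < n -> y < n ->
  counts develop (sigma x) (sigma y) = counts develop x y.
Proof.
move=> k0 hb hx hy; have /permP h := perm_develop k0 hb.
have hd : all (qbelow n) develop.
  apply/allP => g /flattenP [s /mapP [i _ ->]] /mapP [[[[a b] c] d]] /(allP hb).
  by case/and4P=> ha hb' hc hd -> /=; rewrite !iter_lt.
have e a z : a < n -> z < n -> (sigma a == sigma z) = (a == z).
  by move=> ha hz; apply/eqP/eqP => [|-> //]; apply: sigma_inj.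
rewrite /counts -4!h !count_map; congr (_, _, _, _);
  by apply: eq_in_count => -[[[a b] c] d] /(allP hd) /and4P [h1 h2 h3 h4] /=; rewrite !e.
Qed.

End Development.

(** Both the counts of the developed schedule and the prescribed values are invariant under moving
    the two indices together by [sigma]. Hence it suffices to check pairs whose first index lies in
    [R], which meets every orbit. *)
Lemma check_devP n k sigma base R (cw cs : nat -> nat -> nat) :
  (forall x y, x < n -> y < n -> cw (sigma x) (sigma y) = cw x y) ->
  (forall x y, x < n -> y < n -> cs (sigma x) (sigma y) = cs x y) ->
  check_dev n k sigma base R cw cs -> nat_sched n (develop k sigma base) cw cs.
Proof.
move=> hw hs /and5P [k0 /allP h1 /allP hR /allP h2 /andP [hb /allP h3]].
have lt x : x < n -> sigma x < n.
  by move=> hx; have := h1 x; rewrite mem_iota hx => /(_ isT) /andP [].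
have idk x : x < n -> iter k sigma x = x.
  by move=> hx; have := h1 x; rewrite mem_iota hx => /(_ isT) /andP [_ /eqP].
have hbase : all (qbelow n) base.
  apply/allP=> g gb; apply: (allP hb); apply/flattenP.
  exists base; last exact: gb.
  apply/mapP; exists 0; first by rewrite mem_iota.
  by rewrite -[LHS]map_id; apply: eq_map => -[[[a b] c] d].
split=> // x y hx hy.
have ltI i z : z < n -> iter i sigma z < n by elim: i => //= i IH /IH /lt.
have := h2 x; rewrite mem_iota hx => /(_ isT) /hasP [r rR /trajectP [i _ ex]].
have rn := hR r rR.
(* This moves [y] back by [i] steps: the inverse power is written with the nonnegative exponent
   [k * i - i]. *)
pose z := iter (k * i - i) sigma y.
have zn : z < n by apply: ltI.
have ey : y = iter i sigma z.
  rewrite -iterD subnKC ?leq_pmull //.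
  have per j : iter (k * j) sigma y = y by elim: j => [|j IH]; rewrite ?muln0 // mulnS iterD IH idk.
  by rewrite per.
have key j u v : u < n -> v < n ->
    (counts (develop k sigma base) (iter j sigma u) (iter j sigma v) = counts (develop k sigma base) u v) *
    (cw (iter j sigma u) (iter j sigma v) = cw u v) * (cs (iter j sigma u) (iter j sigma v) = cs u v).
  move=> hu hv; elim: j => //= j [[IH1 IH2] IH3].
  by rewrite (counts_sigma lt idk) ?ltI // hw ?hs ?ltI // IH1 IH2 IH3.
rewrite ex ey !key //.
by apply/eqP/(allP (h3 _ rR)); rewrite mem_iota.
Qed.

(** * Frames given by a list of hole sizes, and the spouse counts they yield *)

Definition list_frame (hs : seq nat) := @frame (size hs) (fun j => nth 0 hs j).

Lemma eq_frame c (s s' : 'I_c -> nat) : s =1 s' -> frame s -> frame s'.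
Proof.
move=> e [S hS]; apply: (frame_intro hS) => j.
rewrite -e -sum1_card (eq_bigl (fun x : {j : 'I_c & 'I_(s j)} => (tag x == j) && xpredT (tagged x))).
  rewrite -(sig_big_dep (fun i => i == j) (fun _ => xpredT) (fun _ _ => 1)) /=.
  by rewrite big_pred1_eq sum1_card card_ord.
by move=> x; rewrite inE andbT.
Qed.

(** The orders 0 and 1 are included, so that empty holes and single players can be filled too. *)
Definition good n k :=
  [&& k <= n, ~~ odd (n - k), (n, k) \notin definite_exceptions &
      (n, k) \notin possible_exceptions].

Definition complete n := forall k, good n k -> CM n k.

Definition ks_of h := filter (good h) (iota 0 h.+1).

(** The sumset of the admissible spouse counts of the holes; [undup] keeps the intermediate sets
    short. *)
Definition reach (hs : seq nat) : seq nat :=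
  foldr (fun h acc => undup [seq x + y | x <- ks_of h, y <- acc]) [:: 0] hs.

Lemma reachP hs k : k \in reach hs ->
  exists ks : nat -> nat, (forall j, j < size hs -> good (nth 0 hs j) (ks j)) /\
    k = \sum_(j < size hs) ks j.
Proof.
elim: hs k => [|h hs IH] k /=.
  by rewrite inE => /eqP ->; exists (fun _ => 0); split=> //; rewrite big_ord0.
rewrite mem_undup => /allpairsP [[x y] [hx hy ->]].
have [ks [h1 ->]] := IH _ hy.
exists (fun j => if j is j'.+1 then ks j' else x); split.
  by case=> [|j] /= hj; [move: hx; rewrite mem_filter => /andP [] | apply: h1].
by rewrite big_ord_recl.
Qed.

Lemma fill_values hs (ks : nat -> nat) :
  list_frame hs -> (forall j, j < size hs -> CM (nth 0 hs j) (ks j)) ->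
  CM (sumn hs) (\sum_(j < size hs) ks j).
Proof.
move=> hf hc; rewrite sumnE (big_nth 0) big_mkord.
by apply: (fill_holes (k := fun j => ks j) hf) => j; apply: hc.
Qed.

Lemma fill_list hs k : list_frame hs -> (forall h, h \in hs -> complete h) -> k \in reach hs ->
  CM (sumn hs) k.
Proof.
move=> hf hc /reachP [ks [h1 ->]]; apply: fill_values => // j hj.
by apply: hc; [apply: mem_nth | apply: h1].
Qed.

Lemma card_ord_count n (p : pred nat) : #|[pred x : 'I_n | p x]| = count p (iota 0 n).
Proof.
have -> : iota 0 n = index_iota 0 n by rewrite /index_iota subn0.
by rewrite -sum1_card -sum1_count big_mkord.
Qed.

(** * Frames developed over a cyclic group *)

(* (a, m, tr, base): the points below a * m are Z_(a m) with the residue classes modulo m as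
   holes, the remaining points form the last hole, and base is developed by adding tr. *)
Definition frame_data := (nat * nat * nat * seq (quad nat))%type.

Section CyclicFrame.
Variables (hs : seq nat) (D : frame_data).
Let a := D.1.1.1.
Let m := D.1.1.2.
Let tr := D.1.2.
Let base := D.2.

(** The fixed points go to the last index of [hs] rather than to index [m], so the same data also
    describe a frame with an empty hole inserted before the last one. *)
Definition hole_of x := if x < a * m then x %% m else (size hs).-1.
Definition shift x := if x < a * m then (x + tr) %% (a * m) else x.

(** The orbit representatives are the residues below [tr] and the fixed points. When [tr] equals
    [a * m] the shift is trivial and the base lists the whole frame. *)
Definition check_frame :=
  [&& m < size hs, 0 < a * m,
      all (fun x => hole_of x < size hs) (iota 0 (sumn hs)),
      all (fun j => count (fun x => hole_of x == j) (iota 0 (sumn hs)) == nth 0 hs j)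
          (iota 0 (size hs)) &
      check_dev (sumn hs) (a * m %/ tr) shift base
        (iota 0 tr ++ iota (a * m) (sumn hs - a * m)) (distinct_holes hole_of) (distinct_holes hole_of)].

(** Since [m] divides [a * m], the shift permutes the residue classes modulo [m]; the last hole is
    fixed pointwise and its index is no residue because [m < size hs]. *)
Lemma hole_shift : m < size hs -> 0 < a * m -> forall x y,
  (hole_of (shift x) == hole_of (shift y)) = (hole_of x == hole_of y).
Proof.
move=> hm N0 x y; have m0 : 0 < m by move: N0; rewrite muln_gt0 => /andP [].
have lt z : z %% m == (size hs).-1 = false.
  by apply/eqP => e; have := ltn_pmod z m0; rewrite e; case: (size hs) hm => //= n; lia.
have E z : hole_of (shift z) = if z < a * m then (z + tr) %% m else (size hs).-1.
  rewrite /hole_of /shift; case: (ltnP z (a * m)) => hz; last by rewrite ltnNge hz.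
  by rewrite ltn_pmod // modn_dvdm ?dvdn_mull.
rewrite !E /hole_of; case: ifP => hx; case: ifP => hy.
- by rewrite eqn_modDr.
- by rewrite !lt.
- by rewrite ![(size hs).-1 == _]eq_sym !lt.
- by [].
Qed.

Lemma frame_of_check : check_frame -> list_frame hs.
Proof.
case/and5P=> hm N0 /allP hlt /allP hcnt hdev.
have inv (x y : nat) : x < sumn hs -> y < sumn hs ->
    distinct_holes hole_of (shift x) (shift y) = distinct_holes hole_of x y.
  by move=> _ _; rewrite /distinct_holes hole_shift.
have [S hS] := sched_of_nat (check_devP inv inv hdev).
have lt (x : 'I_(sumn hs)) : hole_of x < size hs by apply: hlt; rewrite mem_iota /=.
pose h x := Ordinal (lt x).
apply: (@frame_intro _ _ h _ S) => [x y|j]; first by rewrite hS.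
have := hcnt j; rewrite mem_iota => /(_ (ltn_ord j)) /eqP <-.
exact: (card_ord_count _ (fun x => hole_of x == j)).
Qed.

End CyclicFrame.

(** * Explicit schedules *)

(* (n, k, mu, games), where mu lists the mates as in cmw. *)
Definition direct_data := (nat * nat * seq nat * seq (quad nat))%type.

Section Direct.
Variable D : direct_data.
Let n := D.1.1.1.
Let k := D.1.1.2.
Let mu x := nth 0 D.1.2 x.

Definition check_direct :=
  [&& all (fun x => (mu x < n) && (mu (mu x) == x)) (iota 0 n),
      count (fun x => mu x == x) (iota 0 n) == k &
      check n D.2 (iota 0 n) (cmw mu) (cms mu)].

Lemma CM_of_check : check_direct -> CM n k.
Proof.
case/and3P=> /allP hmu /eqP hk /check_full hS.
have [S' hS'] := sched_of_nat hS.
have lt (x : 'I_n) : mu x < n by have := hmu x; rewrite mem_iota => /(_ (ltn_ord x)) /andP [].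
exists (fun x => Ordinal (lt x)), S'; split.
- move=> x; apply: val_inj => /=.
  by have := hmu x; rewrite mem_iota => /(_ (ltn_ord x)) /andP [_ /eqP].
- by move=> x y; rewrite hS' /cmw /cms -!val_eqE.
- rewrite -hk -card_ord_count; apply: eq_card => x.
  by rewrite !inE -val_eqE.
Qed.

End Direct.

(** * Transversal designs from lines *)

(** Block [(a, b)] is the line with intercept [a] and slope [b]: column [j] holds [a + j * b] modulo
    [m], and the last column the slope. Two ordinary columns determine [b] because their difference
    is invertible modulo [m], and then [a]; an ordinary column together with the slope determines
    [a] at once. *)
Lemma lines_TD c m : 0 < m -> (forall d, 0 < d < c.-1 -> coprime d m) ->
  exists B : 'I_m * 'I_m -> 'I_c -> 'I_m, transversal_design B.
Proof.
move=> m0 hco.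
pose B (b : 'I_m * 'I_m) (j : 'I_c) : 'I_m :=
  if j.+1 == c then b.2 else Ordinal (ltn_pmod (b.1 + j * b.2) m0).
exists B.
have col2 (j : 'I_c) (a b a' b' : 'I_m) : j.+1 != c -> b = b' ->
    a + j * b = a' + j * b' %[mod m] -> a = a'.
  move=> _ <- /eqP; rewrite eqn_modDr !modn_small ?ltn_ord // => /eqP; exact: val_inj.
have slope (j j' : 'I_c) (a b a' b' : 'I_m) : j < j' -> j'.+1 != c ->
    a + j * b = a' + j * b' %[mod m] -> a + j' * b = a' + j' * b' %[mod m] -> b = b'.
  move=> jj hj' e1 e2; have co : coprime (j' - j) m.
    by apply: hco; rewrite subn_gt0 jj /=; have := ltn_ord j'; lia.
  have e3 : (j' - j) * b = (j' - j) * b' %[mod m].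
    have shift (u w : nat) : w + j * u + (j' - j) * u = w + j' * u.
      by rewrite -addnA -mulnDl subnKC // ltnW.
    have r : a + j * b + (j' - j) * b' = a' + j' * b' %[mod m].
      by rewrite -modnDml e1 modnDml shift.
    by apply/eqP; rewrite -(eqn_modDl (a + j * b)) r shift ?e2.
  (* The slopes are ordered so that the truncated difference [b' - b] is the true one; it is
     divisible by [m] and less than [m], hence zero. *)
  apply: val_inj; wlog le : b b' e3 {e1 e2} / b <= b'.
    by move=> H; case: (leqP b b') => [/H|/ltnW /H]; [exact | move=> h; apply/esym/h].
  move/eqP: e3; rewrite eq_sym eqn_mod_dvd ?leq_mul2l ?le ?orbT // -mulnBr Gauss_dvdr 1?coprime_sym //.
  move=> dv; have lt : b' - b < m by rewrite (leq_ltn_trans (leq_subr _ _)).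
  have [e0|p] := posnP (b' - b).
    by apply/eqP; rewrite eqn_leq le -subn_eq0 e0 /=.
  by have := dvdn_leq p dv; rewrite leqNgt lt.
have val_eqB (j : 'I_c) (b b' : 'I_m * 'I_m) : j.+1 != c -> B b j = B b' j ->
    b.1 + j * b.2 = b'.1 + j * b'.2 %[mod m].
  by rewrite /B => /negPf -> /(congr1 val).
have main (j j' : 'I_c) : j < j' -> injective (fun b => (B b j, B b j')).
  move=> jj [a b] [a' b'] [e e'].
  have hj : j.+1 != c by have := ltn_ord j'; lia.
  have ej := val_eqB _ _ _ hj e.
  have eb : b = b'.
    move: e'; case: (eqVneq j'.+1 c) => [h|h]; first by rewrite /B h eqxx.
    by move/(val_eqB _ _ _ h)/(slope _ _ _ _ _ _ jj h ej).
  by rewrite (col2 j a b a' b' hj eb ej) eb.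
move=> j j' ne; case: (ltngtP j j') => [/main //|/main h|e].
  by move=> b b' [e1 e2]; apply: h; rewrite e1 e2.
by case/eqP: ne; apply: val_inj.
Qed.

(** The integers modulo 4 do not suffice, as 2 is not invertible there. The lines are taken over the
    field with four elements, with 2 for a generator and 3 for its square; column 4 again holds the
    slope. *)
Lemma GF4_TD : exists B : 'I_4 * 'I_4 -> 'I_5 -> 'I_4, transversal_design B.
Proof.
pose add := [:: [:: 0; 1; 2; 3]; [:: 1; 0; 3; 2]; [:: 2; 3; 0; 1]; [:: 3; 2; 1; 0]].
pose mul := [:: [:: 0; 0; 0; 0]; [:: 0; 1; 2; 3]; [:: 0; 2; 3; 1]; [:: 0; 3; 1; 2]].
pose op (t : seq (seq nat)) x y := nth 0 (nth [::] t x) y.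
pose N (a b j : nat) := if j == 4 then b else op add a (op mul j b).
pose r4 := iota 0 4; pose r5 := iota 0 5.
have chk : all (fun j => all (fun a => all (fun b => N a b j < 4) r4) r4) r5 &&
    all (fun j => all (fun j' => (j == j') || all (fun a => all (fun b => all (fun a' => all (fun b' =>
      (N a b j == N a' b' j) && (N a b j' == N a' b' j') ==> (a == a') && (b == b')) r4) r4) r4) r4) r5) r5.
  by vm_compute.
case/andP: chk => /allP lt /allP inj.
have mem4 (x : 'I_4) : (x : nat) \in r4 by rewrite mem_iota /=.
have mem5 (x : 'I_5) : (x : nat) \in r5 by rewrite mem_iota /=.
have lt4 (a b : 'I_4) (j : 'I_5) : N a b j < 4.
  exact: (allP (allP (lt j (mem5 j)) a (mem4 a)) b (mem4 b)).
exists (fun b j => Ordinal (lt4 b.1 b.2 j)) => j j' ne [a b] [a' b'] /= [e1 e2].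
have := allP (inj j (mem5 j)) j' (mem5 j'); rewrite val_eqE (negPf ne) orFb.
move=> /allP /(_ _ (mem4 a)) /allP /(_ _ (mem4 b)) /allP /(_ _ (mem4 a')) /allP /(_ _ (mem4 b')).
rewrite e1 e2 !eqxx /= => /andP [/eqP ea /eqP eb].
by rewrite (val_inj ea) (val_inj eb).
Qed.

(** * Inflation with weights at most 3 *)

(** Greedy splitting of [u] into [c] pieces of size at most [e]; truncated subtraction makes the
    pieces zero once [u] is used up. It distributes weights over a group and, later, spouse pairs
    over holes. *)
Lemma sum_minn c e u : u <= c * e -> \sum_(x < c) minn e (u - x * e) = u.
Proof.
move=> h; suff -> : \sum_(x < c) minn e (u - x * e) = minn (c * e) u by lia.
elim: c {h} => [|c IH]; first by rewrite big_ord0; lia.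
by rewrite big_ord_recr /= IH mulSn; lia.
Qed.

Lemma sum_ltn m t e : t <= m -> \sum_(x < m) (if x < t then e else 0) = e * t.
Proof.
elim: m => [|m IH]; first by rewrite leqn0 => /eqP ->; rewrite big_ord0 muln0.
rewrite big_ord_recr /= leq_eqVlt ltnS => /orP [/eqP ->|h].
  rewrite ltnSn (eq_bigr (fun _ => e)) ?sum_nat_const ?card_ord; first by lia.
  by move=> x _; rewrite (ltn_trans (ltn_ord x)).
by rewrite IH // ltnNge h addn0.
Qed.

Lemma nth_shape (g a b c j : nat) :
  nth 0 (nseq g a ++ [:: b; c]) j = if j < g then a else if j == g then b else if j == g.+1 then c else 0.
Proof.
rewrite nth_cat size_nseq nth_nseq; case: ltnP => // h.
have -> : (j == g) = (j - g == 0) by apply/eqP/eqP; lia.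
have -> : (j == g.+1) = (j - g == 1) by apply/eqP/eqP; lia.
by case: (j - g) => [|[|[|i]]].
Qed.

Lemma inflate_list g m t u :
  (exists B : 'I_m * 'I_m -> 'I_(g.+2) -> 'I_m, transversal_design B) ->
  (forall v, v <= 3 -> list_frame (nseq g 2 ++ [:: 2; v])) ->
  (t < m -> forall v, v <= 3 -> list_frame (nseq g 2 ++ [:: 0; v])) ->
  t <= m -> u <= 3 * m ->
  list_frame (nseq g (2 * m) ++ [:: 2 * t; u]).
Proof.
move=> [B hB] h2 h0 tm um.
have sz a b c : size (nseq g a ++ [:: b; c]) = g.+2 by rewrite size_cat size_nseq addn2.
have list_frameE a b c : list_frame (nseq g a ++ [:: b; c]) <->
    @frame g.+2 (fun j => nth 0 (nseq g a ++ [:: b; c]) j).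
  by rewrite /list_frame sz.
(* Weight 2 on the first [g] groups, weight 2 on the first [t] points of the next group and 0 on its
   others, and weights at most 3 with sum [u] on the last group. *)
pose w (j : 'I_g.+2) (x : 'I_m) :=
  nth 0 (nseq g 2 ++ [:: if x < t then 2 else 0; minn 3 (u - x * 3)]) j.
apply/list_frameE; apply: (@eq_frame _ (fun j => \sum_x w j x)).
  move=> j; rewrite nth_shape /w.
  under eq_bigr => x _ do rewrite nth_shape.
  case: ifP => h; first by rewrite sum_nat_const card_ord mulnC.
  case: ifP => h'; first exact: sum_ltn.
  have -> : (j : nat) == g.+1 by have := ltn_ord j; lia.
  by apply: sum_minn; rewrite mulnC.
apply: (inflate hB) => b.
pose x := B b (inord g); pose y := B b ord_max.
apply: (@eq_frame _ (fun j => nth 0 (nseq g 2 ++ [:: if x < t then 2 else 0; minn 3 (u - y * 3)]) j)).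
  move=> j; rewrite /w !nth_shape; case: ifP => // _; case: ifP => [/eqP e|_].
    by rewrite /x; have -> // : inord g = j by apply: val_inj; rewrite /= inordK // e.
  case: ifP => // /eqP e; rewrite /y; have -> // : j = ord_max by apply: val_inj.
apply/list_frameE; case: ifP => h; first by apply: h2; exact: geq_minl.
apply: h0; last exact: geq_minl.
by have := ltn_ord x; lia.
Qed.

(** * From symmetric schedules to CMDRRs *)

Lemma CMDRR_of_CM n k : CM n k -> CMDRR_exists n k.
Proof.
case=> mu [S [muK hS hk]].
pose P := [set p : 'I_n * 'I_n | (p.1 == p.2) && (mu p.1 == p.1)].
pose G (g : quad 'I_n) := let: (a, b, c, d) := g in Game a b c d.
have cnt x y : [/\ count (partners x y) (map G S) = cmw mu x y,
    count (opp_mw x y) (map G S) = cmw mu x y, count (opp_mm x y) (map G S) = cms mu x y &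
    count (opp_ww x y) (map G S) = cms mu x y].
  rewrite !count_map; have [e1 e2 e3 e4] := hS x y.
  by split; [rewrite -e1 | rewrite -e2 | rewrite -e3 | rewrite -e4];
    apply: eq_count => -[[[a b] c] d].
have inP x y : ((x, y) \in P) = (x == y) && (mu x == x) by rewrite inE.
have hm m : has_spouse_m P m <-> mu m = m.
  split=> [[w]|e]; first by rewrite inP => /andP [_ /eqP].
  by exists m; rewrite inP e !eqxx.
have hw w : has_spouse_w P w <-> mu w = w.
  split=> [[m]|e]; first by rewrite inP => /andP [/eqP <- /eqP].
  by exists w; rewrite inP e !eqxx.
have cms1 m m' : mu m = m -> m' != m -> cms mu m m' = 1.
  by move=> e ne; rewrite /cms e eq_sym ne (negPf ne).
have cms2 m m' : m' != m -> m' != mu m -> cms mu m m' = 1.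
  by move=> ne ne'; rewrite /cms eq_sym ne (negPf ne').
have cms3 m : mu m != m -> cms mu m (mu m) = 2.
  by move=> ne; rewrite /cms eq_sym ne eqxx.
exists P, (map G S); split.
- by split=> -[a b] [c d]; rewrite !inP => /andP [/eqP <- _] /andP [/eqP <- _] /= ->.
- rewrite -hk -(card_image (f := fun x : 'I_n => (x, x))) => [|x y [] //].
  apply: eq_card => -[x y]; rewrite inP; apply/andP/imageP => [[/eqP <- hx]|[z hz [-> ->]]].
    by exists x; rewrite // inE.
  by move: hz; rewrite inE.
split.
(* A game with two equal men or two equal women would count as an encounter of a player with itself,
   but [cms] vanishes on the diagonal. *)
- rewrite all_map; apply/allP => -[[[a b] c] d] gS; apply/andP; split; apply/eqP => /= e.
    have [_ _ + _] := hS a a; move/eqP; rewrite /cms eqxx /= eqn0Ngt -has_count => /hasPn /(_ _ gS) /=.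
    by rewrite -e !eqxx.
  have [_ _ _] := hS b b; move/eqP; rewrite /cms eqxx /= eqn0Ngt -has_count => /hasPn /(_ _ gS) /=.
  by rewrite -e !eqxx.
- by move=> m w; rewrite inP => h; have [-> -> _ _] := cnt m w; rewrite /cmw; case/andP: h => /eqP <- ->; rewrite eqxx.
- by move=> m w; rewrite inP => h; have [-> -> _ _] := cnt m w; rewrite /cmw h.
- by split=> m h m' ne; have [_ _ e1 e2] := cnt m m'; rewrite ?e1 ?e2; apply: cms1 => //; first [exact/hm | exact/hw].
- split=> m h; have ne : mu m != m by apply/eqP => e; apply: h; first [exact/hm | exact/hw].
    exists (mu m); split=> //; first by move/hm; rewrite muK => e; rewrite -e eqxx in ne.
      by have [_ _ -> _] := cnt m (mu m); apply: cms3.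
    by move=> m' h1 h2; have [_ _ -> _] := cnt m m'; apply: cms2.
  exists (mu m); split=> //; first by move/hw; rewrite muK => e; rewrite -e eqxx in ne.
    by have [_ _ _ ->] := cnt m (mu m); apply: cms3.
  by move=> m' h1 h2; have [_ _ _ ->] := cnt m m'; apply: cms2.
Qed.

(** * Exhaustive search for the nonexistence cases *)

Lemma oww_sym (T : eqType) (x y : T) g : oww x y g = oww y x g.
Proof. by case: g => [[[a b] c] d] /=; rewrite orbC andbC [(b == x) && _]andbC. Qed.

(* The spouse pairs are (M_i, F_i) for i < k. *)
Section Search.
Variables n k : nat.

(** Two different games of one schedule share no partnership and no mixed opposition. Two women may
    meet twice if both are unmarried, so their opposition is tested only when one has a spouse.
    Oppositions of men are governed by the list of pairs over which the search runs. *)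
Definition compatible (g g' : quad nat) :=
  let: (a, b, c, d) := g in
  [&& ~~ prt a b g', ~~ prt c d g', ~~ opw a d g', ~~ opw c b g' &
      ~~ (((b < k) || (d < k)) && oww b d g')].

Definition candidates (p : nat * nat) : seq (quad nat) :=
  let: (i, j) := p in
  [seq (i, x.1, j, x.2) | x <- [seq (b, d) | b <- iota 0 n, d <- iota 0 n] &
     [&& x.1 != x.2, ~~ ((x.1 == i) && (i < k)), ~~ ((x.2 == i) && (i < k)),
         ~~ ((x.1 == j) && (j < k)) & ~~ ((x.2 == j) && (j < k))]].

(* A pair of men who meet twice is listed a second time in decreasing order. *)
Definition man_pairs :=
  [seq p <- [seq (i, j) | i <- iota 0 n, j <- iota 0 n] |
     (p.1 < p.2) || [&& n == k + 2, p.2 == k & p.1 == k.+1]].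

Lemma man_pairsP i j : (i, j) \in man_pairs ->
  [/\ i < n, j < n & (i < j) || [&& n == k + 2, j == k & i == k.+1]].
Proof.
rewrite mem_filter => /andP [/= ij /allpairsP [[x y] [+ + [ex ey]]]].
by rewrite -{}ex -{}ey !mem_iota.
Qed.

(** Backtracking with forward checking: a branch dies as soon as some pair of men has no candidate
    left. Exhausted fuel gives [true], so only the answer [false] carries information. *)
Fixpoint search (fuel : nat) (cs : seq (seq (quad nat))) : bool :=
  if fuel is fuel'.+1 then
    if cs is c :: cs' then
      if has (@nilp _) cs then false
      else has (fun g => search fuel' (map (filter (compatible g)) cs')) c
    else true
  else true.

(** A pairwise compatible choice [G] marks a branch that survives every filtering, so the search
    cannot fail along it. *)
Lemma search_complete fuel (L : seq (nat * nat)) (C : nat * nat -> seq (quad nat)) G :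
  uniq L -> {in L, forall p, G p \in C p} ->
  {in L &, forall p q, p != q -> compatible (G p) (G q)} -> search fuel (map C L).
Proof.
elim: fuel L C => //= fuel IH [|p L] //= C /andP [pL uL] hC hG.
have -> : nilp (C p) || has (@nilp _) (map C L) = false.
  apply/negbTE; rewrite negb_or; apply/andP; split.
    by have := hC p (mem_head _ _); case: (C p).
  rewrite has_map -all_predC; apply/allP => q qL /=.
  by have := hC q; rewrite inE qL orbT => /(_ isT); case: (C q).
apply/hasP; exists (G p); first by apply: hC; rewrite mem_head.
rewrite -map_comp; apply: IH => //.
  move=> q qL /=; rewrite mem_filter hC ?inE ?qL ?orbT // andbT.
  by apply: hG; rewrite ?inE ?eqxx ?qL ?orbT //; apply: contraNneq pL => ->.
by move=> q r qL rL; apply: hG; rewrite inE ?qL ?rL orbT.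
Qed.

Definition swap (g : quad nat) : quad nat := let: (a, b, c, d) := g in (c, d, a, b).

Variable S : seq (quad nat).
Hypothesis S_ok : forall g, g \in S -> let: (a, b, c, d) := g in
  [&& a < n, b < n, c < n, d < n & b != d].
Hypothesis S_spouse : forall i, i < k -> (count (prt i i) S = 0) * (count (opw i i) S = 0).
Hypothesis S_mw : forall i j, i < n -> j < n -> ~~ ((i == j) && (i < k)) ->
  (count (prt i j) S = 1) * (count (opw i j) S = 1).
Hypothesis S_mm : forall p, p \in man_pairs -> (p.2 < p.1) < count (omm p.1 p.2) S.
Hypothesis S_ww : forall i j, i < k -> j < n -> j != i -> count (oww i j) S = 1.

Let count_compat (P : pred (quad nat)) g g' : g \in S -> g' \in S -> g != g' ->
  count P S <= 1 -> P g -> ~~ P g'.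
Proof.
move=> gS gS' ne h Pg; apply/negP => Pg'; move: h; rewrite leqNgt => /negP; apply.
rewrite -size_filter; apply: (@uniq_leq_size _ [:: g; g']) => [|x].
  by rewrite /= inE ne.
by rewrite !inE mem_filter => /orP [] /eqP ->; rewrite ?Pg ?Pg'.
Qed.

Let compat_in g g' : g \in S -> g' \in S -> g != g' -> compatible g g'.
Proof.
move=> gS gS' ne; have := S_ok gS.
have := @count_compat _ _ _ gS gS' ne; case: g gS ne => [[[a b] c] d] gS ne H /and5P [ha hb hc hd bd].
have mw i j : i < n -> j < n -> (count (prt i j) S <= 1) && (count (opw i j) S <= 1).
  move=> hi hj; case: (boolP ((i == j) && (i < k))) => [/andP [/eqP <- ik]|h].
    by rewrite !S_spouse.
  by rewrite !S_mw.
have [/andP [ab _] /andP [cd _]] := (mw a b ha hb, mw c d hc hd).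
have [/andP [_ ad] /andP [_ cb]] := (mw a d ha hd, mw c b hc hb).
apply/and5P; split.
- by apply: H ab _; rewrite /= !eqxx.
- by apply: H cd _; rewrite /= !eqxx orbT.
- by apply: H ad _; rewrite /= !eqxx.
- by apply: H cb _; rewrite /= !eqxx orbT.
- apply/negP => /andP [/orP [bk|dk]]; apply/negP.
    have le : count (oww b d) S <= 1 by rewrite S_ww // eq_sym.
    by apply: (H _ le); rewrite /= !eqxx.
  have le : count (oww d b) S <= 1 by rewrite S_ww.
  have : ~~ oww d b g' by apply: (H _ le); rewrite /= !eqxx orbT.
  by rewrite oww_sym.
Qed.

Let compat_swap g g' :
  (compatible (swap g) g' = compatible g g') * (compatible g (swap g') = compatible g g').
Proof.
split; last first.
  case: g g' => [[[a b] c] d] [[[a' b'] c'] d'] /=.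
  by rewrite ![(c' == _) && _ || _]orbC ![(d' == _) && _ || _]orbC.
case: g => [[[a b] c] d]; rewrite /compatible /= [oww d b _]oww_sym [(d < k) || _]orbC.
by rewrite andbCA; congr (_ && (_ && _)); rewrite andbCA.
Qed.

(** A schedule provides a pairwise compatible choice, one game for each listed pair of men. *)
Lemma search_true fuel : search fuel (map candidates man_pairs).
Proof.
have mpP p : p \in man_pairs -> [/\ p.1 < n, p.2 < n & p.1 != p.2].
  by case: p => i j /man_pairsP [-> -> ij]; split=> //; move: ij => /=; lia.
(* The comparison [p.2 < p.1] serves as position: 0 selects the first meeting of the two men, 1 the
   second meeting for a pair listed in decreasing order. *)
pose H p := nth (0, 0, 0, 0) (filter (omm p.1 p.2) S) (p.2 < p.1).
have HP p : p \in man_pairs -> (H p \in S) && omm p.1 p.2 (H p).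
  move=> hp; have : H p \in filter (omm p.1 p.2) S by rewrite mem_nth // size_filter S_mm.
  by rewrite mem_filter andbC.
(* A repeated game would repeat a partnership. *)
have uS : uniq S.
  apply: count_mem_uniq => g; case: (boolP (g \in S)) => [gS|/count_memPn -> //].
  apply/eqP; rewrite eqn_leq -has_count has_pred1 gS andbT.
  have := S_ok gS; case: g gS => [[[a b] c] d] gS /and5P [ha hb _ _ _].
  apply: leq_trans (_ : count (prt a b) S <= 1).
    by apply: sub_count => g /eqP ->; rewrite /= !eqxx.
  case: (boolP ((a == b) && (a < k))) => [/andP [/eqP <- ak]|h].
    by rewrite S_spouse.
  by rewrite S_mw.
have Hinj p q : p \in man_pairs -> q \in man_pairs -> H p = H q -> p = q.
  move=> hp hq e; have /andP [_ op] := HP p hp; have /andP [_ oq] := HP q hq.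
  rewrite -e in oq; have [_ _ np] := mpP p hp; have [_ _ nq] := mpP q hq.
  have [//|ne] := eqVneq p q.
  (* Different pairs sharing a game are reverses of each other; they would then select different
     positions in the same duplicate-free list. *)
  have eq12 : q = (p.2, p.1).
    apply/eqP; move: ne op oq np nq; rewrite -!pair_eqE /pair_eq /=.
    by case: (H p) => [[[a b] c] d]; case: (p) (q) => [p1 p2] [q1 q2] /=; lia.
  have om : omm q.1 q.2 =1 omm p.1 p.2.
    by case=> [[[a b] c] d]; rewrite eq12 /= orbC andbC [(c == _) && _]andbC.
  have sp := S_mm hp; have := S_mm hq; rewrite (eq_count om) => sq.
  move/eqP: e; rewrite /H (eq_filter om) nth_uniq ?size_filter ?filter_uniq //.
  by move: np; rewrite eq12 /=; case: ltngtP.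
(* The teams are interchanged if necessary, so that the first man of [p] plays in the first team as
   in [candidates]. *)
pose G p := if (H p).1.1.1 == p.1 then H p else swap (H p).
have hG p : G p = H p \/ G p = swap (H p) by rewrite /G; case: ifP; [left | right].
apply: (@search_complete _ _ _ G).
- by rewrite filter_uniq // allpairs_uniq ?iota_uniq // => -[? ?] [? ?].
- case=> i j hp; have [/= iN jn ij] := mpP _ hp; have /andP [+ /= +] := HP _ hp.
  rewrite /G /=; move: (H (i, j)) => g gS og.
  have := S_ok gS; case: g gS og => [[[a b] c] d] gS og /and5P [ha hb hc hd bd].
  have spouse m : m < k -> ~~ prt m m (a, b, c, d) && ~~ opw m m (a, b, c, d).
    move=> mk; have [/eqP h1 /eqP h2] := S_spouse mk.
    move: h1 h2; rewrite !eqn0Ngt -!has_count => /hasPn h1 /hasPn h2.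
    by rewrite (h1 _ gS) (h2 _ gS).
  have mem b' d' : b' < n -> d' < n -> b' != d' ->
      (forall m, m < k -> (m == i) || (m == j) -> (b' != m) && (d' != m)) ->
      (i, b', j, d') \in candidates (i, j).
    move=> hb' hd' ne h; apply/mapP; exists (b', d') => //.
    rewrite mem_filter /= ne /=; apply/andP; split; last first.
      by apply/allpairsP; exists (b', d'); rewrite !mem_iota.
    have E m : (m == i) || (m == j) -> ~~ ((b' == m) && (m < k)) && ~~ ((d' == m) && (m < k)).
      by move=> hm; case: (ltnP m k) => mk; rewrite ?andbF // !andbT h.
    have /andP [-> ->] : ~~ ((b' == i) && (i < k)) && ~~ ((d' == i) && (i < k)).
      by apply: E; rewrite eqxx.
    by apply: E; rewrite eqxx orbT.
  have [ei|ne] /= := eqVneq a i.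
    have ej : c = j by move: og ij => /=; lia.
    rewrite -{1}ei -{1}ej; subst a c; apply: mem => // m mk.
    have := spouse m mk; rewrite /= ; lia.
  have [ei ej] : c = i /\ a = j by move: og ij => /=; lia.
  subst a c; apply: mem => //; first by rewrite eq_sym.
  move=> m mk; have := spouse m mk; rewrite /= ; lia.
- move=> p q hp hq ne; have : compatible (H p) (H q).
    have [/andP [h1 _] /andP [h2 _]] := (HP p hp, HP q hq).
    by apply: compat_in => //; apply: contraNneq ne => /(Hinj _ _ hp hq) ->.
  by case: (hG p) => ->; case: (hG q) => ->; rewrite ?compat_swap.
Qed.

End Search.

(** * Normalizing a CMDRR for the search *)

(** Numbers the players so that those of [s] come first in their given order; applied to the married
    men and to the married women. *)
Lemma enumeration_extending n (s : seq 'I_n.+1) : uniq s ->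
  exists (rank : 'I_n.+1 -> nat) (nthp : nat -> 'I_n.+1),
    [/\ forall x, rank x < n.+1, cancel rank nthp,
        forall i, i < n.+1 -> rank (nthp i) = i & forall i, i < size s -> nthp i = nth ord0 s i].
Proof.
move=> us; pose t := s ++ [seq x <- enum 'I_n.+1 | x \notin s].
have ut : uniq t.
  rewrite cat_uniq us filter_uniq ?enum_uniq // andbT; apply/hasPn => x.
  by rewrite mem_filter => /andP [].
have tall x : x \in t by rewrite mem_cat mem_filter mem_enum andbT orbN.
have st : size t = n.+1.
  have /perm_size -> : perm_eq t (enum 'I_n.+1).
    by apply: uniq_perm; rewrite ?enum_uniq // => x; rewrite tall mem_enum.
  by rewrite size_enum_ord.
exists (fun x => index x t), (fun i => nth ord0 t i); split.
- by move=> x; rewrite -[X in _ < X]st index_mem.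
- by move=> x; rewrite nth_index.
- by move=> i hi; rewrite index_uniq // st.
- by move=> i hi; rewrite nth_cat hi.
Qed.

(** Men and women are renumbered along one enumeration of the spouse pairs, so that [(M i, W i)] for
    [i < k] are exactly these pairs; the axioms then become the hypotheses of [search_true]. *)
Lemma search_of_CMDRR fuel n k : CMDRR_exists n.+1 k ->
  search k fuel [seq candidates n.+1 k p | p <- man_pairs n.+1 k].
Proof.
case=> P [S [[inj1 inj2] cP [hok h0 h1 [hm1 hw1] [hm2 _]]]].
have ue := enum_uniq P; have se : size (enum P) = k by rewrite -cardE.
have u1 : uniq (map fst (enum P)).
  rewrite map_inj_in_uniq // => p q; rewrite !mem_enum => hp hq; exact: inj1.
have u2 : uniq (map snd (enum P)).
  rewrite map_inj_in_uniq // => p q; rewrite !mem_enum => hp hq; exact: inj2.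
have [al [M [alt alK MK M0]]] := enumeration_extending u1.
have [be [W [bet beK WK W0]]] := enumeration_extending u2.
have kn : k <= n.+1.
  by rewrite -se -(size_map fst) -(card_uniqP u1) -[X in _ <= X]card_ord max_card.
pose z : 'I_n.+1 * 'I_n.+1 := (ord0, ord0).
have inP i : i < k -> (M i, W i) \in P.
  move=> ik; rewrite M0 ?W0 ?size_map ?se // !(nth_map z) ?se // -surjective_pairing.
  by rewrite -mem_enum mem_nth ?se.
have Minj i j : i < n.+1 -> j < n.+1 -> M i = M j -> i = j.
  by move=> hi hj e; rewrite -(MK i hi) -(MK j hj) e.
have Winj i j : i < n.+1 -> j < n.+1 -> W i = W j -> i = j.
  by move=> hi hj e; rewrite -(WK i hi) -(WK j hj) e.
have Pin i j : i < n.+1 -> j < n.+1 -> (M i, W j) \in P -> (i == j) && (i < k).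
  move=> hi hj h; have h' : (M i, W j) \in enum P by rewrite mem_enum.
  pose t := index (M i, W j) (enum P); have tk : t < k by rewrite -se index_mem.
  have et : nth z (enum P) t = (M i, W j) by rewrite nth_index.
  have eM : M t = M i by rewrite M0 ?size_map ?se // (nth_map z) ?se // et.
  have eW : W t = W j by rewrite W0 ?size_map ?se // (nth_map z) ?se // et.
  have tn := leq_trans tk kn.
  by rewrite -(Minj _ _ tn hi eM) -(Winj _ _ tn hj eW) eqxx.
have spm i : i < n.+1 -> has_spouse_m P (M i) <-> i < k.
  move=> hi; split=> [[w]|ik]; last by exists (W i); apply: inP.
  by rewrite -(beK w) => /(Pin _ _ hi (bet w)) /andP [].
have spw i : i < k -> has_spouse_w P (W i) by move=> ik; exists (M i); apply: inP.
pose S' := [seq (al (gm1 g), be (gf1 g), al (gm2 g), be (gf2 g)) | g <- S].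
have alE x i : i < n.+1 -> (al x == i) = (x == M i).
  by move=> hi; apply/eqP/eqP => [<-|->]; rewrite ?alK ?MK.
have beE x i : i < n.+1 -> (be x == i) = (x == W i).
  by move=> hi; apply/eqP/eqP => [<-|->]; rewrite ?beK ?WK.
have c1 i j : i < n.+1 -> j < n.+1 -> count (prt i j) S' = count (partners (M i) (W j)) S.
  by move=> hi hj; rewrite count_map; apply: eq_count => g /=; rewrite !alE // !beE.
have c2 i j : i < n.+1 -> j < n.+1 -> count (opw i j) S' = count (opp_mw (M i) (W j)) S.
  by move=> hi hj; rewrite count_map; apply: eq_count => g /=; rewrite !alE // !beE.
have c3 i j : i < n.+1 -> j < n.+1 -> count (omm i j) S' = count (opp_mm (M i) (M j)) S.
  by move=> hi hj; rewrite count_map; apply: eq_count => g /=; rewrite !alE.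
have c4 i j : i < n.+1 -> j < n.+1 -> count (oww i j) S' = count (opp_ww (W i) (W j)) S.
  by move=> hi hj; rewrite count_map; apply: eq_count => g /=; rewrite !beE.
have Mne i j : i < n.+1 -> j < n.+1 -> i != j -> M i != M j.
  by move=> hi hj; apply: contraNneq => /(Minj _ _ hi hj) ->.
have Wne i j : i < n.+1 -> j < n.+1 -> i != j -> W i != W j.
  by move=> hi hj; apply: contraNneq => /(Winj _ _ hi hj) ->.
apply: (@search_true _ _ S').
- have : all (fun g : quad nat => let: (a, b, c, d) := g in
      [&& a < n.+1, b < n.+1, c < n.+1, d < n.+1 & b != d]) S'.
    rewrite all_map; apply: sub_all hok => g /andP [_ h] /=.
    by rewrite !alt !bet (inj_eq (can_inj beK)).
  by move/allP => H g /H.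
- move=> i ik; have hi := leq_trans ik kn.
  by rewrite c1 ?c2 //; have [-> ->] := h0 _ _ (inP i ik).
- move=> i j hi hj h; rewrite c1 ?c2 //.
  by have [] := h1 (M i) (W j); [apply: contraNN h; apply: Pin | move=> -> ->].
- case=> i j /man_pairsP [hi hj ij]; rewrite /= c3 //.
  have ne : j != i by move: ij; lia.
  have [ik|ki] := ltnP i k.
    rewrite (hm1 (M i)) //; [by move: ij; lia | exact/spm | exact: Mne].
  have nsp : ~ has_spouse_m P (M i) by move/(spm _ hi); rewrite ltnNge ki.
  have [m' [ne' nsp' e2 e1]] := hm2 _ nsp.
  have [em|nem] := eqVneq (M j) m'; first by rewrite em e2; case: (j < i).
  rewrite e1 ?Mne //; case: (ltnP i j) ij => [lt _|_ /=]; first by rewrite ltnS leqn0 eqb0 -leqNgt ltnW.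
  (* Here [i] is [k + 1] and [j] is [k], the only unmarried men. The mate of [M i] is unmarried and
     differs from [M i], so it is [M j], against [nem]. *)
  case/and3P=> /eqP en /eqP ej /eqP ei; case/negP: nem; apply/eqP.
  have := alt m'; have : ~ (al m' < k) by move=> h; apply: nsp'; rewrite -(alK m'); apply/(spm _ (alt m')).
  have : al m' != i by apply: contraNneq ne' => e; rewrite -e alK.
  move=> h2 h3 h4; rewrite -(alK m'); congr M; move: h2 h3 h4; lia.
- move=> i j ik hj ne; have hi := leq_trans ik kn; rewrite c4 // (hw1 (W i)) //; last exact: Wne.
  exact: spw.
Qed.

Lemma no_CMDRR n k : (n, k) \in definite_exceptions -> ~ CMDRR_exists n k.
Proof.
have : all (fun p => ~~ search p.2 (p.1 * p.1) [seq candidates p.1 p.2 q | q <- man_pairs p.1 p.2])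
  definite_exceptions by vm_compute.
(* For [n = 0] the fuel is 0, the search answers [true] and the assumption is absurd. *)
move=> /allP h /h; case: n => [|n]; first by [].
by move=> /negP h' /(search_of_CMDRR (n.+1 * n.+1)) /h'.
Qed.

(** * Tables of schedules and base games *)

(** All good pairs of order below 12, followed by [(13, 5)], [(14, 8)] and [(14, 10)], which the
    cyclic frames do not reach. *)
Definition direct_schedules : seq direct_data := [::
 (0, 0, [::], [::]);
 (1, 1, [:: 0], [::]);
 (2, 0, [:: 1; 0],
  [::
   (0,0,1,1); (0,1,1,0)]);
 (3, 1, [:: 0; 2; 1],
  [::
   (0,1,2,2); (0,2,1,1); (1,0,2,1); (1,2,2,0)]);
 (4, 0, [:: 1; 0; 3; 2],
  [::
   (0,0,3,1); (0,1,1,3); (0,2,1,0); (0,3,2,2); (1,1,2,0); (1,2,3,3); (2,1,3,2); (2,3,3,0)]);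
 (4, 4, [:: 0; 1; 2; 3],
  [::
   (0,1,2,3); (0,2,3,1); (0,3,1,2); (1,0,3,2); (1,3,2,0); (2,1,3,0)]);
 (5, 1, [:: 0; 2; 1; 4; 3],
  [::
   (0,1,1,4); (0,2,2,3); (0,3,4,1); (0,4,3,2); (1,0,3,3); (1,1,2,2); (1,2,4,0); (1,3,2,4);
   (2,0,4,4); (2,1,3,0); (3,1,4,2); (3,4,4,3)]);
 (5, 5, [:: 0; 1; 2; 3; 4],
  [::
   (0,1,3,2); (0,2,1,4); (0,3,4,1); (0,4,2,3); (1,0,3,4); (1,2,4,3); (1,3,2,0); (2,1,4,0);
   (2,4,3,1); (3,0,4,2)]);
 (6, 0, [:: 1; 0; 3; 2; 5; 4],
  [::
   (0,0,4,3); (0,1,3,4); (0,2,5,0); (0,3,1,2); (0,4,1,5); (0,5,2,1); (1,0,2,5); (1,1,5,2);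
   (1,3,4,1); (1,4,3,0); (2,0,3,1); (2,2,3,3); (2,3,5,4); (2,4,4,2); (3,2,4,5); (3,5,5,3);
   (4,0,5,1); (4,4,5,5)]);
 (6, 4, [:: 0; 1; 2; 3; 5; 4],
  [::
   (0,1,3,2); (0,2,5,5); (0,3,4,1); (0,4,2,3); (0,5,1,4); (1,0,4,2); (1,2,3,4); (1,3,2,0);
   (1,5,5,3); (2,1,4,5); (2,4,5,1); (2,5,3,0); (3,1,5,0); (3,5,4,4); (4,0,5,4); (4,3,5,2)]);
 (7, 1, [:: 0; 2; 1; 4; 3; 6; 5],
  [::
   (0,1,4,4); (0,2,3,3); (0,3,5,5); (0,4,6,6); (0,5,2,2); (0,6,1,1); (1,0,6,3); (1,2,2,1);
   (1,3,3,4); (1,4,5,2); (1,5,4,0); (1,6,2,5); (2,0,5,4); (2,3,6,1); (2,4,4,3); (2,6,3,0);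
   (3,1,5,0); (3,2,4,1); (3,5,6,4); (3,6,4,5); (4,2,6,0); (4,6,5,3); (5,1,6,5); (5,6,6,2)]);
 (7, 3, [:: 0; 1; 2; 4; 3; 6; 5],
  [::
   (0,1,4,6); (0,2,3,1); (0,3,5,4); (0,4,2,5); (0,5,1,3); (0,6,6,2); (1,0,3,4); (1,2,5,0);
   (1,4,4,2); (1,5,6,6); (1,6,2,3); (2,0,4,5); (2,1,5,3); (2,4,6,1); (2,6,3,0); (3,2,4,3);
   (3,3,6,4); (3,5,4,1); (3,6,5,5); (4,0,6,3); (4,4,5,6); (5,1,6,0); (5,2,6,5)]);
 (7, 5, [:: 0; 1; 2; 3; 4; 6; 5],
  [::
   (0,1,6,4); (0,2,1,5); (0,3,5,1); (0,4,3,6); (0,5,2,3); (0,6,4,2); (1,0,4,5); (1,2,5,4);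
   (1,3,2,6); (1,4,6,3); (1,6,3,0); (2,0,6,1); (2,1,4,6); (2,4,5,0); (2,5,3,4); (3,1,5,2);
   (3,2,6,0); (3,5,4,1); (4,0,5,3); (4,3,6,2); (5,5,6,6); (5,6,6,5)]);
 (7, 7, [:: 0; 1; 2; 3; 4; 5; 6],
  [::
   (0,1,6,5); (0,2,5,3); (0,3,4,1); (0,4,3,6); (0,5,2,4); (0,6,1,2); (1,0,2,3); (1,3,6,4);
   (1,4,5,2); (1,5,4,0); (1,6,3,5); (2,0,4,6); (2,1,3,4); (2,5,6,3); (2,6,5,1); (3,0,6,2);
   (3,1,5,0); (3,2,4,5); (4,2,6,1); (4,3,5,6); (5,4,6,0)]);
 (8, 0, [:: 1; 0; 3; 2; 5; 4; 7; 6],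
  [::
   (0,0,3,1); (0,1,4,6); (0,2,5,5); (0,3,6,0); (0,4,2,2); (0,5,1,7); (0,6,1,4); (0,7,7,3);
   (1,0,5,7); (1,1,2,0); (1,2,7,1); (1,3,4,4); (1,5,3,3); (1,6,6,2); (2,1,5,3); (2,3,3,6);
   (2,4,6,5); (2,5,4,0); (2,6,7,7); (2,7,3,2); (3,0,4,2); (3,4,5,1); (3,5,7,4); (3,7,6,6);
   (4,1,6,7); (4,3,7,2); (4,5,5,6); (4,7,5,4); (5,0,7,6); (5,2,6,3); (6,1,7,5); (6,4,7,0)]);
 (8, 2, [:: 0; 1; 3; 2; 5; 4; 7; 6],
  [::
   (0,1,6,5); (0,2,7,3); (0,3,5,1); (0,4,1,6); (0,5,2,7); (0,6,3,2); (0,7,4,4); (1,0,2,6);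
   (1,2,3,5); (1,3,6,7); (1,4,5,3); (1,5,4,0); (1,7,7,2); (2,0,7,1); (2,1,3,7); (2,2,6,3);
   (2,3,3,6); (2,4,4,2); (2,5,5,4); (3,0,5,7); (3,1,7,4); (3,3,4,5); (3,4,6,0); (4,1,5,2);
   (4,3,7,0); (4,6,6,1); (4,7,5,6); (5,0,6,2); (5,5,7,6); (6,4,7,5); (6,6,7,7)]);
 (8, 4, [:: 0; 1; 2; 3; 5; 4; 7; 6],
  [::
   (0,1,2,4); (0,2,7,1); (0,3,6,5); (0,4,5,6); (0,5,3,2); (0,6,4,7); (0,7,1,3); (1,0,4,2);
   (1,2,3,4); (1,4,6,0); (1,5,2,6); (1,6,7,3); (1,7,5,5); (2,0,5,3); (2,1,6,7); (2,3,4,4);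
   (2,5,7,0); (2,7,3,6); (3,0,6,6); (3,1,5,0); (3,5,4,1); (3,7,7,4); (4,0,7,7); (4,3,5,1);
   (4,5,6,4); (4,6,5,2); (5,4,7,5); (5,7,6,2); (6,1,7,6); (6,3,7,2)]);
 (8, 6, [:: 0; 1; 2; 3; 4; 5; 7; 6],
  [::
   (0,1,3,2); (0,2,4,5); (0,3,6,1); (0,4,2,3); (0,5,7,7); (0,6,5,4); (0,7,1,6); (1,0,7,6);
   (1,2,3,4); (1,3,2,0); (1,4,6,5); (1,5,4,3); (1,7,5,2); (2,1,7,5); (2,4,5,0); (2,5,3,6);
   (2,6,6,7); (2,7,4,1); (3,0,4,7); (3,1,5,6); (3,5,6,0); (3,7,7,4); (4,0,5,1); (4,2,6,6);
   (4,6,7,3); (5,3,7,2); (5,7,6,3); (6,2,7,0); (6,4,7,1)]);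
 (8, 8, [:: 0; 1; 2; 3; 4; 5; 6; 7],
  [::
   (0,1,3,7); (0,2,4,1); (0,3,5,2); (0,4,6,3); (0,5,7,4); (0,6,1,5); (0,7,2,6); (1,0,7,3);
   (1,2,5,7); (1,3,4,5); (1,4,2,0); (1,6,3,2); (1,7,6,4); (2,1,7,5); (2,3,6,1); (2,4,5,6);
   (2,5,3,0); (2,7,4,3); (3,1,5,4); (3,4,7,2); (3,5,6,7); (3,6,4,0); (4,2,6,5); (4,6,7,1);
   (4,7,5,0); (5,1,6,0); (5,3,7,6); (6,2,7,0)]);
 (9, 1, [:: 0; 2; 1; 4; 3; 6; 5; 8; 7],
  [::
   (0,1,4,8); (0,2,3,7); (0,3,1,4); (0,4,2,3); (0,5,5,6); (0,6,6,5); (0,7,7,1); (0,8,8,2);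
   (1,0,2,6); (1,1,6,4); (1,2,8,1); (1,3,7,8); (1,5,2,0); (1,6,3,2); (1,7,5,5); (1,8,4,7);
   (2,1,7,2); (2,2,5,3); (2,4,8,7); (2,5,4,1); (2,7,3,8); (2,8,6,6); (3,0,7,4); (3,1,5,0);
   (3,3,6,1); (3,4,4,5); (3,5,8,8); (3,6,4,3); (4,0,8,3); (4,2,6,0); (4,4,5,2); (4,6,7,7);
   (5,1,8,6); (5,4,6,8); (5,7,6,3); (5,8,7,0); (6,2,7,5); (6,7,8,0); (7,3,8,5); (7,6,8,4)]);
 (9, 3, [:: 0; 1; 2; 6; 7; 8; 3; 4; 5],
  [::
   (0,1,6,4); (0,2,8,1); (0,3,3,5); (0,4,5,8); (0,5,2,7); (0,6,4,2); (0,7,7,6); (0,8,1,3);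
   (1,0,6,2); (1,2,7,5); (1,4,4,3); (1,5,3,6); (1,6,2,4); (1,7,5,0); (1,8,8,7); (2,0,8,3);
   (2,1,7,0); (2,3,4,7); (2,5,5,4); (2,6,6,8); (2,8,3,1); (3,0,7,4); (3,2,5,7); (3,3,6,6);
   (3,4,8,2); (3,7,6,1); (3,8,4,0); (4,1,8,5); (4,4,7,7); (4,5,6,0); (4,6,5,1); (4,8,7,2);
   (5,2,6,3); (5,3,7,1); (5,5,8,8); (5,6,8,0); (6,5,7,8); (6,7,8,4); (7,3,8,6)]);
 (9, 5, [:: 0; 1; 2; 3; 4; 7; 8; 5; 6],
  [::
   (0,1,4,6); (0,2,1,7); (0,3,2,8); (0,4,3,5); (0,5,5,1); (0,6,6,2); (0,7,7,3); (0,8,8,4);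
   (1,0,5,5); (1,2,4,8); (1,3,7,4); (1,4,6,0); (1,5,2,3); (1,6,8,7); (1,8,3,6); (2,0,6,6);
   (2,1,7,0); (2,4,8,1); (2,5,4,7); (2,6,3,4); (2,7,5,8); (3,0,7,7); (3,1,5,2); (3,2,8,0);
   (3,7,4,1); (3,8,6,5); (4,0,8,8); (4,2,6,3); (4,3,5,0); (4,5,7,6); (5,3,8,6); (5,4,7,2);
   (5,6,7,8); (5,7,6,4); (6,1,8,3); (6,7,8,5); (6,8,7,1); (7,5,8,2)]);
 (9, 7, [:: 0; 1; 2; 3; 4; 5; 6; 8; 7],
  [::
   (0,1,6,7); (0,2,4,1); (0,3,7,6); (0,4,3,5); (0,5,2,8); (0,6,8,4); (0,7,1,2); (0,8,5,3);
   (1,0,8,5); (1,3,5,2); (1,4,7,0); (1,5,4,6); (1,6,3,8); (1,7,2,3); (1,8,6,4); (2,0,4,8);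
   (2,1,8,6); (2,4,6,3); (2,5,7,1); (2,6,5,0); (2,7,3,4); (3,0,6,1); (3,1,5,8); (3,2,8,0);
   (3,6,7,2); (3,7,4,5); (4,0,7,3); (4,2,6,8); (4,3,8,1); (4,7,5,6); (5,1,7,4); (5,4,8,2);
   (5,7,6,0); (6,2,7,5); (6,5,8,3); (7,7,8,8); (7,8,8,7)]);
 (9, 9, [:: 0; 1; 2; 3; 4; 5; 6; 7; 8],
  [::
   (0,1,7,4); (0,2,8,5); (0,3,1,6); (0,4,2,7); (0,5,3,8); (0,6,4,1); (0,7,5,2); (0,8,6,3);
   (1,0,8,2); (1,2,6,4); (1,3,2,0); (1,4,5,8); (1,5,7,6); (1,7,4,5); (1,8,3,7); (2,1,4,8);
   (2,3,7,5); (2,4,3,0); (2,5,6,1); (2,6,8,7); (2,8,5,6); (3,1,6,7); (3,2,5,1); (3,4,8,6);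
   (3,5,4,0); (3,6,7,2); (4,2,7,8); (4,3,6,2); (4,6,5,0); (4,7,8,3); (5,3,8,1); (5,4,7,3);
   (5,7,6,0); (6,5,8,4); (6,8,7,0); (7,1,8,0)]);
 (10, 0, [:: 5; 6; 7; 8; 9; 0; 1; 2; 3; 4],
  [::
   (0,0,7,8); (0,1,3,3); (0,2,5,7); (0,3,2,6); (0,4,8,1); (0,5,1,9); (0,6,6,5); (0,7,5,2);
   (0,8,9,4); (0,9,4,0); (1,0,5,1); (1,1,8,9); (1,2,4,4); (1,3,6,8); (1,4,3,7); (1,5,9,2);
   (1,6,2,0); (1,7,7,6); (1,8,6,3); (2,1,6,2); (2,2,9,0); (2,3,5,5); (2,4,7,9); (2,5,4,8);
   (2,7,3,1); (2,8,8,7); (2,9,7,4); (3,0,8,5); (3,2,7,3); (3,4,6,6); (3,5,8,0); (3,6,5,9);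
   (3,8,4,2); (3,9,9,8); (4,1,9,6); (4,3,8,4); (4,5,7,7); (4,6,9,1); (4,7,6,0); (4,9,5,3);
   (5,0,6,4); (5,4,9,5); (5,6,8,8); (5,8,7,1); (6,1,7,5); (6,7,9,9); (6,9,8,2); (7,0,9,3);
   (7,2,8,6); (8,3,9,7)]);
 (10, 2, [:: 0; 1; 3; 2; 5; 4; 7; 6; 9; 8],
  [::
   (0,1,5,5); (0,2,8,6); (0,3,9,1); (0,4,7,3); (0,5,2,4); (0,6,4,7); (0,7,3,9); (0,8,6,2);
   (0,9,1,8); (1,0,4,4); (1,2,9,7); (1,3,8,0); (1,4,2,5); (1,5,6,3); (1,6,3,8); (1,7,5,6);
   (1,9,7,2); (2,0,6,6); (2,1,7,7); (2,2,3,3); (2,3,3,2); (2,6,5,9); (2,7,4,8); (2,8,9,0);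
   (2,9,8,1); (3,0,8,9); (3,1,9,8); (3,4,5,1); (3,5,4,0); (3,6,7,5); (3,7,6,4); (4,1,8,2);
   (4,2,7,4); (4,3,5,8); (4,5,9,9); (4,6,6,1); (4,9,5,3); (5,0,9,2); (5,2,6,5); (5,4,8,8);
   (5,7,7,0); (6,0,7,1); (6,7,8,3); (6,8,7,9); (6,9,9,4); (7,6,9,3); (7,8,8,5); (8,4,9,6);
   (8,7,9,5)]);
 (10, 4, [:: 0; 1; 2; 3; 5; 4; 8; 9; 6; 7],
  [::
   (0,1,6,5); (0,2,1,8); (0,3,5,6); (0,4,9,9); (0,5,7,2); (0,6,8,4); (0,7,3,1); (0,8,4,3);
   (0,9,2,7); (1,0,4,7); (1,2,7,4); (1,3,2,9); (1,4,8,3); (1,5,6,6); (1,6,3,8); (1,7,9,5);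
   (1,9,5,0); (2,0,3,6); (2,1,5,8); (2,3,8,5); (2,4,7,7); (2,5,9,0); (2,6,4,1); (2,8,6,4);
   (3,0,9,4); (3,2,4,9); (3,4,6,1); (3,5,8,8); (3,7,5,2); (3,9,7,5); (4,0,7,3); (4,2,9,1);
   (4,4,5,5); (4,5,5,4); (4,6,6,9); (4,8,8,7); (5,1,8,0); (5,3,6,2); (5,7,7,6); (5,9,9,8);
   (6,0,8,2); (6,3,9,7); (6,7,8,9); (6,8,7,0); (7,1,9,3); (7,8,9,6); (7,9,8,1); (8,6,9,2)]);
 (10, 6, [:: 0; 1; 2; 3; 4; 5; 7; 6; 9; 8],
  [::
   (0,1,5,6); (0,2,9,9); (0,3,6,5); (0,4,2,3); (0,5,4,7); (0,6,8,2); (0,7,3,1); (0,8,7,4);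
   (0,9,1,8); (1,0,4,6); (1,2,6,4); (1,3,8,8); (1,4,5,7); (1,5,3,2); (1,6,9,3); (1,7,2,0);
   (1,9,7,5); (2,1,4,5); (2,4,7,1); (2,5,9,6); (2,6,5,9); (2,7,8,3); (2,8,6,0); (2,9,3,8);
   (3,0,5,4); (3,4,8,6); (3,5,7,0); (3,6,4,8); (3,7,9,2); (3,9,6,1); (4,0,6,2); (4,1,9,8);
   (4,2,5,3); (4,3,7,9); (4,9,8,7); (5,0,8,9); (5,1,6,3); (5,2,7,8); (5,8,9,7); (6,6,7,7);
   (6,7,7,6); (6,8,8,5); (6,9,9,4); (7,2,8,1); (7,3,9,0); (8,0,9,1); (8,4,9,5)]);
 (10, 8, [:: 0; 1; 2; 3; 4; 5; 6; 7; 9; 8],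
  [::
   (0,1,4,5); (0,2,7,9); (0,3,5,4); (0,4,2,8); (0,5,9,7); (0,6,8,1); (0,7,3,6); (0,8,6,2);
   (0,9,1,3); (1,0,4,7); (1,2,5,6); (1,4,6,5); (1,5,3,8); (1,6,9,0); (1,7,8,2); (1,8,7,3);
   (1,9,2,4); (2,0,8,3); (2,1,5,0); (2,3,6,7); (2,5,7,6); (2,6,4,8); (2,7,9,1); (2,9,3,5);
   (3,0,9,2); (3,1,8,4); (3,2,6,1); (3,4,7,0); (3,7,5,8); (3,9,4,6); (4,0,6,8); (4,1,9,3);
   (4,2,8,5); (4,3,7,2); (4,9,5,7); (5,1,7,8); (5,2,9,4); (5,3,8,6); (5,9,6,0); (6,3,9,5);
   (6,4,8,7); (6,9,7,1); (7,4,9,6); (7,5,8,0); (8,8,9,9); (8,9,9,8)]);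
 (10, 10, [:: 0; 1; 2; 3; 4; 5; 6; 7; 8; 9],
  [::
   (0,1,4,5); (0,2,5,6); (0,3,6,7); (0,4,7,8); (0,5,8,9); (0,6,9,1); (0,7,1,2); (0,8,2,3);
   (0,9,3,4); (1,0,5,3); (1,3,2,5); (1,4,9,2); (1,5,7,6); (1,6,3,9); (1,7,8,4); (1,8,6,0);
   (1,9,4,8); (2,0,6,4); (2,1,5,9); (2,4,3,6); (2,6,8,7); (2,7,4,1); (2,8,9,5); (2,9,7,0);
   (3,0,7,5); (3,1,8,0); (3,2,6,1); (3,5,4,7); (3,7,9,8); (3,8,5,2); (4,0,8,6); (4,2,9,0);
   (4,3,7,2); (4,6,5,8); (4,9,6,3); (5,0,9,7); (5,1,7,4); (5,4,8,3); (5,7,6,9); (6,2,8,5);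
   (6,5,9,4); (6,8,7,1); (7,3,9,6); (7,9,8,2); (8,1,9,3)]);
 (11, 1, [:: 0; 6; 7; 8; 9; 10; 1; 2; 3; 4; 5],
  [::
   (0,1,10,6); (0,2,1,7); (0,3,2,8); (0,4,3,9); (0,5,4,10); (0,6,5,1); (0,7,6,2); (0,8,7,3);
   (0,9,8,4); (0,10,9,5); (1,0,6,7); (1,1,2,4); (1,2,6,0); (1,3,10,10); (1,4,9,8); (1,5,5,3);
   (1,6,8,5); (1,8,4,9); (1,9,7,1); (1,10,3,6); (2,0,7,8); (2,1,4,7); (2,2,3,5); (2,3,7,0);
   (2,5,10,9); (2,6,6,4); (2,7,9,6); (2,9,5,10); (2,10,8,2); (3,0,8,9); (3,1,9,3); (3,2,5,8);
   (3,3,4,6); (3,4,8,0); (3,7,7,5); (3,8,10,7); (3,10,6,1); (4,0,9,10); (4,1,7,2); (4,2,10,4);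
   (4,3,6,9); (4,4,5,7); (4,5,9,0); (4,8,8,6); (5,0,10,1); (5,2,8,3); (5,4,7,10); (5,5,6,8);
   (5,6,10,0); (5,9,9,7); (6,3,9,4); (6,5,8,1); (6,6,7,9); (6,10,10,8); (7,4,10,5); (7,6,9,2);
   (7,7,8,10); (8,7,10,3); (8,8,9,1); (9,9,10,2)]);
 (11, 3, [:: 0; 1; 2; 4; 3; 8; 9; 10; 5; 6; 7],
  [::
   (0,1,3,6); (0,2,4,1); (0,3,1,8); (0,4,7,10); (0,5,9,7); (0,6,5,9); (0,7,10,4); (0,8,6,2);
   (0,9,8,5); (0,10,2,3); (1,0,4,2); (1,2,3,7); (1,3,2,9); (1,4,5,8); (1,5,8,4); (1,6,10,5);
   (1,7,6,10); (1,9,7,0); (1,10,9,6); (2,0,3,5); (2,1,4,0); (2,4,6,9); (2,5,7,8); (2,6,9,4);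
   (2,7,8,6); (2,8,10,7); (2,10,5,1); (3,0,6,7); (3,1,7,5); (3,2,5,6); (3,3,4,4); (3,4,4,3);
   (3,8,8,10); (3,9,9,8); (3,10,10,9); (4,5,10,8); (4,6,8,9); (4,7,9,10); (4,8,7,6); (4,9,5,7);
   (4,10,6,5); (5,0,8,8); (5,2,9,5); (5,3,7,7); (5,4,10,1); (5,5,6,3); (5,10,8,0); (6,0,10,6);
   (6,1,9,9); (6,4,8,2); (6,6,7,3); (6,8,9,1); (7,1,8,7); (7,2,10,10); (7,4,9,0); (7,9,10,2);
   (8,1,10,3); (8,3,9,2); (9,3,10,0)]);
 (11, 5, [:: 0; 1; 2; 3; 4; 6; 5; 9; 10; 7; 8],
  [::
   (0,1,3,10); (0,2,4,7); (0,3,1,8); (0,4,2,9); (0,5,5,6); (0,6,6,5); (0,7,10,1); (0,8,7,2);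
   (0,9,8,3); (0,10,9,4); (1,0,2,10); (1,2,10,5); (1,3,5,4); (1,4,6,7); (1,5,7,9); (1,6,9,2);
   (1,7,8,6); (1,9,4,0); (1,10,3,8); (2,0,3,7); (2,1,6,8); (2,3,7,5); (2,4,5,1); (2,5,8,10);
   (2,6,10,3); (2,7,4,9); (2,8,9,6); (3,0,4,8); (3,1,5,2); (3,2,6,9); (3,4,8,5); (3,5,9,7);
   (3,6,7,4); (3,9,10,6); (4,1,9,5); (4,2,5,3); (4,3,6,10); (4,5,10,8); (4,6,8,1); (4,10,7,6);
   (5,0,6,6); (5,5,6,0); (5,7,7,8); (5,8,8,9); (5,9,9,10); (5,10,10,7); (6,1,10,9); (6,2,7,10);
   (6,3,8,7); (6,4,9,8); (7,0,10,4); (7,1,8,0); (7,3,9,1); (7,7,9,9); (8,2,9,0); (8,4,10,2);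
   (8,8,10,10); (9,3,10,0)]);
 (11, 7, [:: 0; 1; 2; 3; 4; 5; 6; 8; 7; 10; 9],
  [::
   (0,1,4,3); (0,2,3,4); (0,3,6,9); (0,4,5,10); (0,5,9,2); (0,6,10,1); (0,7,2,8); (0,8,1,7);
   (0,9,8,5); (0,10,7,6); (1,0,3,7); (1,2,6,0); (1,3,2,4); (1,4,9,5); (1,5,7,3); (1,6,5,9);
   (1,8,8,6); (1,9,4,10); (1,10,10,2); (2,0,4,8); (2,1,5,0); (2,3,10,6); (2,5,6,10); (2,6,8,4);
   (2,7,7,5); (2,9,9,1); (2,10,3,9); (3,0,5,6); (3,1,9,4); (3,2,8,9); (3,5,10,8); (3,6,4,5);
   (3,8,7,1); (3,10,6,7); (4,0,6,5); (4,1,7,10); (4,2,10,3); (4,6,9,7); (4,7,8,2); (4,9,5,8);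
   (5,1,6,2); (5,2,7,8); (5,3,8,10); (5,4,10,7); (5,7,9,3); (6,1,8,7); (6,3,9,8); (6,4,7,9);
   (6,8,10,4); (7,0,8,3); (7,2,9,6); (7,4,8,0); (7,7,10,9); (8,1,10,5); (8,8,9,10); (9,0,10,10);
   (9,9,10,0)]);
 (11, 9, [:: 0; 1; 2; 3; 4; 5; 6; 7; 8; 10; 9],
  [::
   (0,1,10,8); (0,2,6,1); (0,3,8,6); (0,4,3,5); (0,5,7,9); (0,6,4,10); (0,7,1,4); (0,8,9,3);
   (0,9,2,7); (0,10,5,2); (1,0,9,4); (1,2,10,0); (1,3,7,2); (1,5,4,6); (1,6,8,9); (1,7,5,10);
   (1,8,2,5); (1,9,3,8); (1,10,6,3); (2,0,3,6); (2,1,9,5); (2,3,10,1); (2,4,8,3); (2,6,5,7);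
   (2,8,6,10); (2,9,4,0); (2,10,7,4); (3,0,7,10); (3,1,4,7); (3,2,9,6); (3,4,10,2); (3,7,6,8);
   (3,9,5,1); (3,10,8,5); (4,1,8,10); (4,2,5,8); (4,3,9,7); (4,5,10,3); (4,8,7,0); (4,9,6,2);
   (5,0,8,1); (5,3,6,0); (5,4,9,8); (5,6,10,4); (5,9,7,3); (6,4,7,1); (6,5,9,0); (6,7,10,5);
   (6,9,8,4); (7,5,8,2); (7,6,9,1); (7,8,10,6); (8,0,10,7); (8,7,9,2); (9,9,10,10); (9,10,10,9)]);
 (11, 11, [:: 0; 1; 2; 3; 4; 5; 6; 7; 8; 9; 10],
  [::
   (0,1,9,8); (0,2,7,5); (0,3,5,2); (0,4,3,10); (0,5,1,7); (0,6,10,4); (0,7,8,1); (0,8,6,9);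
   (0,9,4,6); (0,10,2,3); (1,0,3,4); (1,2,10,9); (1,3,8,6); (1,4,6,3); (1,5,4,0); (1,6,2,8);
   (1,8,9,2); (1,9,7,10); (1,10,5,7); (2,0,6,8); (2,1,4,5); (2,4,9,7); (2,5,7,4); (2,6,5,1);
   (2,7,3,9); (2,9,10,3); (2,10,8,0); (3,0,9,1); (3,1,7,9); (3,2,5,6); (3,5,10,8); (3,6,8,5);
   (3,7,6,2); (3,8,4,10); (4,1,10,2); (4,2,8,10); (4,3,6,7); (4,7,9,6); (4,8,7,3); (4,9,5,0);
   (5,3,9,0); (5,4,7,8); (5,8,10,7); (5,9,8,4); (5,10,6,1); (6,0,7,2); (6,4,10,1); (6,5,8,9);
   (6,10,9,5); (7,0,10,6); (7,1,8,3); (7,6,9,10); (8,2,9,4); (8,7,10,0); (9,3,10,5)]);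
 (13, 5, [:: 0; 1; 2; 3; 4; 9; 10; 11; 12; 5; 6; 7; 8],
  [::
   (0,1,10,11); (0,2,11,12); (0,3,12,9); (0,4,9,10); (0,5,7,4); (0,6,8,1); (0,7,5,2); (0,8,6,3);
   (0,9,4,5); (0,10,1,6); (0,11,2,7); (0,12,3,8); (1,0,10,2); (1,2,9,3); (1,3,8,11); (1,4,12,6);
   (1,5,3,7); (1,7,4,9); (1,8,5,5); (1,9,6,12); (1,10,2,8); (1,11,11,4); (1,12,7,0); (2,0,11,3);
   (2,1,9,7); (2,3,10,4); (2,4,5,12); (2,5,6,6); (2,6,4,8); (2,9,8,0); (2,10,7,9); (2,11,3,5);
   (2,12,12,1); (3,0,12,4); (3,1,6,9); (3,2,10,8); (3,4,11,1); (3,6,7,7); (3,9,9,2); (3,10,5,0);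
   (3,11,8,10); (3,12,4,6); (4,0,9,1); (4,1,12,2); (4,2,7,10); (4,3,11,5); (4,7,8,8);
   (4,10,10,3); (4,11,6,0); (4,12,5,11); (5,1,7,3); (5,3,9,6); (5,4,8,9); (5,6,11,2); (5,7,9,0);
   (5,8,12,11); (5,9,10,5); (5,10,6,1); (6,2,8,4); (6,4,10,7); (6,5,9,12); (6,7,12,3);
   (6,8,10,0); (6,10,11,6); (6,11,7,2); (7,1,11,8); (7,5,11,0); (7,6,10,9); (7,8,9,4);
   (7,11,12,7); (7,12,8,3); (8,2,12,5); (8,5,10,1); (8,6,12,0); (8,7,11,10); (8,12,9,8);
   (9,5,12,10); (9,9,11,11); (9,11,10,6); (10,10,12,12); (10,12,11,7); (11,9,12,8)]);
 (14, 8, [:: 0; 1; 2; 3; 4; 5; 6; 7; 9; 8; 12; 13; 10; 11],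
  [::
   (0,1,10,9); (0,2,6,4); (0,3,2,1); (0,4,13,10); (0,5,3,12); (0,6,5,11); (0,7,4,8); (0,8,7,3);
   (0,9,11,5); (0,10,12,2); (0,11,8,7); (0,12,9,13); (0,13,1,6); (1,0,3,2); (1,2,11,9);
   (1,3,7,5); (1,4,5,8); (1,5,10,11); (1,7,6,12); (1,8,4,0); (1,9,12,6); (1,10,2,7); (1,11,13,3);
   (1,12,8,4); (1,13,9,10); (2,0,4,6); (2,3,12,9); (2,4,7,13); (2,5,6,8); (2,6,11,12); (2,8,5,1);
   (2,9,13,7); (2,10,9,11); (2,11,3,4); (2,12,10,0); (2,13,8,5); (3,0,13,9); (3,1,5,7);
   (3,5,4,10); (3,6,7,8); (3,7,12,13); (3,8,6,2); (3,9,10,4); (3,10,8,6); (3,11,9,12);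
   (3,13,11,1); (4,1,8,12); (4,2,12,1); (4,3,10,13); (4,5,9,2); (4,7,13,6); (4,9,7,10);
   (4,11,5,9); (4,12,11,3); (4,13,6,11); (5,0,11,10); (5,2,8,13); (5,3,13,2); (5,4,10,7);
   (5,6,9,3); (5,10,7,12); (5,12,6,9); (5,13,12,0); (6,0,10,3); (6,1,12,11); (6,3,8,10);
   (6,5,11,4); (6,7,9,0); (6,10,13,1); (6,13,7,9); (7,0,8,11); (7,1,11,0); (7,2,13,12);
   (7,4,9,1); (7,6,12,5); (7,11,10,2); (8,0,12,4); (8,1,13,5); (8,2,10,6); (8,3,11,7); (8,8,9,9);
   (8,9,9,8); (9,4,12,3); (9,5,13,0); (9,6,10,1); (9,7,11,2); (10,5,12,7); (10,8,13,13);
   (10,10,11,8); (10,12,12,10); (11,6,13,4); (11,11,12,8); (11,13,13,11); (12,12,13,8)]);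
 (14, 10, [:: 0; 1; 2; 3; 4; 5; 6; 7; 8; 9; 11; 10; 13; 12],
  [::
   (0,1,4,8); (0,2,5,13); (0,3,13,11); (0,4,1,5); (0,5,11,3); (0,6,8,4); (0,7,3,2); (0,8,10,7);
   (0,9,2,12); (0,10,12,1); (0,11,7,9); (0,12,6,10); (0,13,9,6); (1,0,5,9); (1,2,12,11);
   (1,3,4,12); (1,4,11,2); (1,6,2,3); (1,7,9,5); (1,8,3,13); (1,9,10,6); (1,10,13,0); (1,11,6,8);
   (1,12,8,7); (1,13,7,10); (2,0,13,4); (2,1,10,13); (2,4,8,3); (2,5,12,10); (2,6,7,8);
   (2,7,4,11); (2,8,11,5); (2,9,6,1); (2,10,9,7); (2,11,5,0); (2,13,3,12); (3,0,10,12);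
   (3,1,12,5); (3,4,13,10); (3,5,9,2); (3,6,5,11); (3,7,6,9); (3,8,7,0); (3,9,11,4); (3,10,8,6);
   (3,11,4,1); (4,0,7,5); (4,2,13,6); (4,3,9,8); (4,5,10,9); (4,6,12,0); (4,7,11,13); (4,9,8,10);
   (4,10,6,2); (4,13,5,12); (5,1,6,4); (5,2,8,9); (5,3,12,7); (5,4,10,8); (5,6,11,12);
   (5,7,13,1); (5,8,9,10); (5,10,7,3); (6,0,9,3); (6,3,7,2); (6,5,13,13); (6,7,10,4); (6,11,8,5);
   (6,12,12,8); (6,13,11,0); (7,1,8,2); (7,4,12,12); (7,6,10,5); (7,11,9,4); (7,12,11,1);
   (7,13,13,9); (8,0,11,7); (8,1,9,0); (8,11,12,13); (8,12,13,5); (8,13,10,3); (9,1,11,6);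
   (9,11,13,12); (9,12,10,2); (9,13,12,4); (10,0,12,2); (10,1,13,3); (10,10,11,11);
   (10,11,11,10); (11,8,13,2); (11,9,12,3); (12,6,13,7); (12,9,13,8)])].

(* Entries are (b, (a, m, tr, base)) with b the size of the last hole. *)
Definition weight_two_frames : seq (nat * frame_data) := [::
 (0, (2, 4, 8, [::
   (0,1,3,6); (0,2,7,1); (0,3,1,2); (0,5,2,3); (0,6,5,7); (0,7,6,5); (1,0,2,7); (1,3,6,4);
   (1,4,7,6); (1,6,3,0); (1,7,4,2); (2,0,5,3); (2,1,4,7); (2,4,3,1); (2,5,7,4); (3,2,4,5);
   (3,4,5,2); (3,5,6,0); (4,1,6,3); (4,3,5,6); (4,6,7,5); (5,0,7,2); (5,4,6,7); (6,1,7,0)]));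
 (1, (2, 4, 1, [::
   (0,1,3,2); (0,2,1,7); (0,3,8,5); (0,5,2,8)]));
 (2, (2, 4, 1, [::
   (0,1,9,6); (0,2,3,1); (0,3,1,8); (0,5,8,3); (0,7,2,9)]));
 (3, (2, 4, 1, [::
   (0,1,7,10); (0,2,3,8); (0,3,9,1); (0,5,8,6); (0,6,10,3); (0,7,2,9)]));
 (0, (2, 5, 1, [::
   (0,1,3,9); (0,2,6,3); (0,3,9,7); (0,4,2,1)]));
 (1, (2, 5, 2, [::
   (0,1,9,2); (0,2,1,3); (0,3,10,9); (0,4,7,6); (0,6,8,10); (0,7,6,4); (0,9,3,7); (1,2,3,9);
   (1,8,10,4); (1,9,5,10)]));
 (2, (2, 5, 1, [::
   (0,1,11,3); (0,2,10,9); (0,3,6,2); (0,4,8,10); (0,7,3,1); (0,9,1,11)]));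
 (3, (2, 5, 1, [::
   (0,1,10,9); (0,2,8,12); (0,3,7,10); (0,4,1,7); (0,7,6,11); (0,8,12,2); (0,9,11,8)]));
 (0, (2, 6, 1, [::
   (0,1,3,8); (0,2,10,5); (0,3,1,11); (0,4,7,3); (0,9,8,7)]));
 (1, (2, 6, 1, [::
   (0,1,5,10); (0,2,10,9); (0,3,1,5); (0,7,4,12); (0,8,9,7); (0,9,12,1)]));
 (2, (2, 6, 1, [::
   (0,1,13,11); (0,2,10,9); (0,3,5,2); (0,4,1,8); (0,5,4,13); (0,8,3,12); (0,10,12,7)]));
 (3, (2, 6, 1, [::
   (0,1,3,14); (0,2,7,5); (0,3,1,8); (0,4,13,3); (0,5,12,1); (0,8,4,13); (0,9,14,11); (0,11,2,12)]))].

(** Sorted by order, from 12 to 31. The last four frames serve [n = k] for 34, 35, 38 and 46, where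
    the inflated frame has a last hole of 2, 3 or 6 players, in which not everybody can be
    married. *)
Definition cyclic_frames : seq (nat * frame_data) := [::
 (0, (2, 6, 1, [::
   (0,1,3,8); (0,2,10,5); (0,3,1,11); (0,4,7,3); (0,9,8,7)]));
 (0, (3, 4, 12, [::
   (0,1,10,3); (0,2,9,11); (0,3,5,6); (0,5,3,2); (0,6,7,1); (0,7,2,5); (0,9,11,10); (0,10,1,7);
   (0,11,6,9); (1,0,6,7); (1,2,8,3); (1,3,2,4); (1,4,7,2); (1,6,4,11); (1,8,3,6); (1,10,11,0);
   (1,11,10,8); (2,0,3,5); (2,1,8,11); (2,3,4,9); (2,7,5,8); (2,8,11,1); (2,9,7,4); (2,11,9,0);
   (3,0,9,2); (3,1,6,4); (3,4,5,10); (3,8,10,9); (3,9,4,6); (3,10,8,1); (4,1,11,2); (4,2,5,7);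
   (4,3,9,10); (4,5,10,11); (4,7,6,1); (4,10,7,5); (5,0,7,6); (5,2,11,8); (5,3,10,0); (5,4,6,11);
   (5,11,8,10); (6,0,11,9); (6,3,8,5); (6,5,7,8); (6,8,9,3); (7,0,10,1); (7,9,8,2); (7,10,9,8);
   (8,6,11,5); (8,7,9,6); (8,9,10,7); (9,4,11,6); (9,7,10,4); (10,5,11,4)]));
 (1, (1, 11, 1, [::
   (0,1,9,6); (0,2,1,4); (0,4,11,8); (0,5,6,2); (0,6,8,7); (0,9,4,11)]));
 (3, (1, 9, 1, [::
   (0,1,11,2); (0,2,9,5); (0,3,6,10); (0,4,10,8); (0,5,1,7); (0,7,4,9); (0,8,7,11)]));
 (4, (1, 9, 1, [::
   (0,1,5,9); (0,2,9,6); (0,3,11,1); (0,4,12,3); (0,5,3,10); (0,6,7,12); (0,7,10,4); (0,8,1,11)]));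
 (1, (2, 6, 1, [::
   (0,1,5,10); (0,2,10,9); (0,3,1,5); (0,7,4,12); (0,8,9,7); (0,9,12,1)]));
 (2, (1, 11, 1, [::
   (0,1,10,6); (0,2,3,1); (0,3,9,12); (0,4,11,7); (0,5,7,11); (0,6,12,8); (0,8,5,4)]));
 (4, (2, 5, 1, [::
   (0,1,8,10); (0,2,1,13); (0,3,10,7); (0,4,13,6); (0,6,11,9); (0,7,3,11); (0,8,6,12); (0,9,12,8)]));
 (0, (1, 14, 2, [::
   (0,1,9,5); (0,2,12,8); (0,3,8,12); (0,5,7,2); (0,6,3,10); (0,7,11,1); (0,8,1,3); (0,9,10,7);
   (0,12,13,11); (0,13,5,6); (1,0,5,2); (1,4,13,5); (1,6,9,3)]));
 (3, (1, 11, 1, [::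
   (0,1,13,4); (0,2,3,13); (0,3,9,12); (0,4,6,3); (0,5,11,1); (0,6,10,8); (0,7,12,2); (0,10,4,11)]));
 (4, (1, 11, 1, [::
   (0,1,11,4); (0,2,13,3); (0,3,4,9); (0,4,14,6); (0,6,10,13); (0,7,6,11); (0,8,3,14);
   (0,9,12,2); (0,10,2,12)]));
 (0, (3, 5, 1, [::
   (0,1,7,14); (0,2,4,1); (0,3,14,7); (0,4,13,11); (0,6,9,3); (0,11,3,2)]));
 (1, (2, 7, 1, [::
   (0,1,4,2); (0,2,11,10); (0,3,2,13); (0,4,9,14); (0,5,13,8); (0,6,8,4); (0,8,14,3)]));
 (2, (1, 13, 1, [::
   (0,1,11,5); (0,2,1,12); (0,3,8,4); (0,4,7,2); (0,5,13,11); (0,6,10,14); (0,10,4,13);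
   (0,12,14,7)]));
 (0, (4, 4, 8, [::
   (0,1,2,15); (0,2,15,5); (0,3,6,9); (0,5,14,7); (0,6,3,13); (0,7,10,1); (0,9,11,6);
   (0,10,13,3); (0,11,5,10); (0,13,7,2); (0,14,9,11); (0,15,1,14); (1,0,7,14); (1,2,11,12);
   (1,4,6,7); (1,6,12,11); (1,7,14,8); (1,8,10,3); (1,10,15,0); (1,11,2,4); (1,12,3,10);
   (1,15,4,2); (2,0,5,7); (2,1,11,4); (2,3,4,13); (2,5,12,3); (2,7,13,12); (2,8,3,9); (2,12,7,5);
   (2,13,15,8); (3,0,14,13); (3,1,12,2); (3,2,13,0); (3,5,6,4); (3,6,4,5); (3,8,5,14);
   (4,1,7,10); (4,6,15,1); (4,7,5,2); (4,9,6,11); (4,14,13,7); (4,15,14,5); (5,0,6,3);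
   (5,3,14,4); (5,6,7,12); (5,12,15,14); (6,1,15,12); (6,8,7,1)]));
 (1, (3, 5, 3, [::
   (0,1,15,7); (0,2,11,13); (0,3,7,1); (0,4,13,2); (0,6,14,12); (0,7,3,14); (0,8,1,15);
   (0,9,8,11); (0,12,9,8); (0,13,4,6); (0,15,2,9); (1,0,13,14); (1,4,2,15); (1,7,8,4); (1,8,7,0);
   (1,12,14,13); (1,13,5,9); (1,14,15,5); (2,3,15,6); (2,8,11,5); (2,10,14,11)]));
 (3, (1, 13, 1, [::
   (0,1,7,15); (0,2,10,13); (0,3,13,9); (0,4,1,6); (0,6,4,1); (0,7,8,14); (0,8,14,4);
   (0,9,11,10); (0,11,15,8)]));
 (1, (4, 4, 2, [::
   (0,1,16,3); (0,2,1,15); (0,3,9,14); (0,5,10,16); (0,6,13,7); (0,7,2,1); (0,9,7,10);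
   (0,10,11,13); (0,11,5,2); (0,13,15,6); (0,14,3,9); (1,0,3,16); (1,2,11,4); (1,12,16,6)]));
 (2, (1, 15, 1, [::
   (0,1,3,5); (0,3,4,10); (0,4,7,1); (0,5,2,16); (0,7,1,9); (0,10,15,11); (0,11,9,15);
   (0,12,16,7); (0,13,5,4)]));
 (2, (4, 4, 1, [::
   (0,1,7,14); (0,2,1,16); (0,3,13,2); (0,6,17,11); (0,9,10,7); (0,10,5,3); (0,11,14,17);
   (0,15,16,9)]));
 (5, (1, 13, 1, [::
   (0,1,15,11); (0,2,13,8); (0,3,10,4); (0,4,16,2); (0,5,6,15); (0,6,5,16); (0,8,17,3);
   (0,9,14,5); (0,10,1,13); (0,11,4,14); (0,12,2,17)]));
 (0, (3, 6, 2, [::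
   (0,1,11,16); (0,2,3,7); (0,3,10,17); (0,4,7,8); (0,5,2,13); (0,8,15,5); (0,9,17,10);
   (0,10,9,1); (0,13,4,2); (0,14,5,4); (0,15,1,14); (0,17,13,15); (1,4,9,6); (1,8,5,3);
   (1,10,3,17)]));
 (3, (4, 4, 1, [::
   (0,1,17,10); (0,2,11,16); (0,3,2,9); (0,5,10,3); (0,6,7,5); (0,10,13,17); (0,11,16,6);
   (0,13,15,18); (0,15,18,2)]));
 (4, (1, 15, 1, [::
   (0,1,3,17); (0,2,17,3); (0,3,7,5); (0,4,2,14); (0,5,10,9); (0,6,15,12); (0,7,14,15);
   (0,8,16,1); (0,9,18,6); (0,10,6,18); (0,11,4,16)]));
 (1, (3, 6, 2, [::
   (0,1,8,18); (0,2,17,15); (0,3,1,2); (0,4,5,1); (0,5,2,16); (0,7,15,5); (0,8,4,17);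
   (0,9,18,13); (0,10,9,14); (0,11,13,8); (0,15,11,10); (0,16,7,9); (0,17,3,7); (1,4,9,6);
   (1,8,18,16); (1,10,17,9); (1,12,5,18)]));
 (0, (4, 5, 1, [::
   (0,1,17,9); (0,2,9,16); (0,3,16,14); (0,4,7,3); (0,6,8,2); (0,8,2,1); (0,9,1,12); (0,13,14,11)]));
 (5, (3, 5, 1, [::
   (0,1,15,4); (0,2,1,16); (0,3,12,11); (0,4,11,18); (0,6,17,12); (0,7,19,9); (0,8,9,19);
   (0,9,2,15); (0,11,8,17); (0,12,18,13); (0,13,16,2)]));
 (3, (1, 17, 1, [::
   (0,1,19,6); (0,2,3,18); (0,3,15,10); (0,4,8,15); (0,5,13,4); (0,6,11,3); (0,10,16,14);
   (0,11,17,2); (0,13,5,17); (0,14,7,19); (0,16,18,1)]));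
 (1, (4, 5, 1, [::
   (0,1,13,12); (0,2,20,16); (0,3,16,4); (0,4,2,11); (0,6,9,3); (0,7,1,19); (0,11,17,13);
   (0,12,14,20); (0,13,12,9)]));
 (6, (1, 15, 1, [::
   (0,1,11,16); (0,2,5,19); (0,3,9,20); (0,4,1,18); (0,5,7,6); (0,6,13,17); (0,7,16,1);
   (0,8,17,11); (0,9,18,4); (0,10,19,2); (0,11,15,7); (0,12,20,14); (0,13,3,15)]));
 (0, (3, 7, 1, [::
   (0,1,6,19); (0,2,3,6); (0,4,10,9); (0,5,2,13); (0,6,16,5); (0,8,12,10); (0,9,1,18);
   (0,12,8,2); (0,16,4,1)]));
 (2, (4, 5, 1, [::
   (0,1,12,4); (0,2,19,18); (0,3,7,11); (0,6,18,12); (0,7,6,14); (0,9,16,7); (0,13,20,2);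
   (0,16,17,21); (0,17,11,20); (0,18,21,17)]));
 (4, (3, 6, 2, [::
   (0,1,15,11); (0,2,11,13); (0,3,5,19); (0,4,2,1); (0,5,18,4); (0,7,4,21); (0,8,10,7);
   (0,9,20,5); (0,10,17,14); (0,11,1,20); (0,13,21,15); (0,14,19,9); (0,16,9,18); (0,18,13,17);
   (0,19,7,8); (0,20,3,10); (1,0,5,3); (1,4,17,9); (1,6,18,15); (1,9,19,2); (1,10,20,0);
   (1,12,9,21); (1,14,21,16)]));
 (5, (1, 17, 1, [::
   (0,1,14,5); (0,2,9,12); (0,4,10,21); (0,5,6,20); (0,6,16,17); (0,7,4,18); (0,9,21,15);
   (0,10,2,1); (0,11,5,19); (0,12,20,9); (0,13,18,14); (0,14,17,2); (0,15,19,13)]));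
 (3, (4, 5, 1, [::
   (0,1,22,4); (0,2,1,8); (0,3,12,16); (0,6,17,20); (0,8,9,7); (0,9,6,17); (0,12,20,14);
   (0,13,21,2); (0,14,2,18); (0,17,4,21); (0,19,13,22)]));
 (4, (1, 19, 1, [::
   (0,1,19,15); (0,2,15,20); (0,3,12,5); (0,4,2,11); (0,5,11,21); (0,6,16,14); (0,7,22,8);
   (0,8,21,12); (0,10,9,4); (0,11,14,22); (0,13,6,3); (0,15,20,18); (0,18,1,19)]));
 (5, (3, 6, 2, [::
   (0,1,18,14); (0,2,13,4); (0,3,1,18); (0,4,2,19); (0,5,15,10); (0,7,19,17); (0,8,17,7);
   (0,9,22,8); (0,10,9,21); (0,11,8,20); (0,13,20,15); (0,14,21,5); (0,15,14,22); (0,16,11,9);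
   (0,17,3,13); (0,18,5,16); (0,21,7,11); (1,0,3,20); (1,2,18,17); (1,3,21,0); (1,4,11,22);
   (1,6,20,14); (1,8,19,4); (1,15,5,19); (1,16,22,5)]));
 (7, (2, 8, 1, [::
   (0,1,7,16); (0,2,15,21); (0,3,19,6); (0,4,16,13); (0,5,3,18); (0,6,11,20); (0,7,22,1);
   (0,9,21,4); (0,10,17,12); (0,11,4,17); (0,12,14,19); (0,13,20,9); (0,14,18,15); (0,15,10,22)]));
 (0, (4, 6, 1, [::
   (0,1,17,3); (0,2,19,11); (0,3,2,17); (0,4,13,9); (0,5,10,21); (0,7,21,20); (0,8,9,4);
   (0,9,4,2); (0,13,23,16); (0,14,16,13)]));
 (6, (3, 6, 2, [::
   (0,1,3,18); (0,2,19,4); (0,3,13,17); (0,4,11,20); (0,5,10,22); (0,7,16,14); (0,8,7,21);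
   (0,9,17,19); (0,10,18,7); (0,11,20,16); (0,13,23,11); (0,14,22,15); (0,15,21,8); (0,17,14,23);
   (0,18,5,10); (0,19,1,2); (0,20,9,1); (0,21,15,5); (1,0,9,22); (1,3,22,16); (1,4,20,3);
   (1,8,5,0); (1,10,23,6); (1,12,21,15); (1,15,19,5); (1,16,3,23); (1,17,18,8)]));
 (7, (1, 17, 1, [::
   (0,1,7,19); (0,2,19,8); (0,3,21,1); (0,4,1,21); (0,5,20,6); (0,6,14,20); (0,7,9,18);
   (0,8,12,23); (0,9,2,14); (0,10,6,22); (0,11,17,2); (0,13,23,16); (0,14,4,17); (0,15,18,5);
   (0,16,22,12)]));
 (1, (4, 6, 1, [::
   (0,1,5,16); (0,2,15,5); (0,3,4,14); (0,4,1,9); (0,5,3,19); (0,7,10,8); (0,9,24,1);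
   (0,13,22,17); (0,15,17,13); (0,17,13,10); (0,23,16,24)]));
 (4, (3, 7, 1, [::
   (0,1,18,22); (0,2,8,12); (0,3,23,1); (0,5,10,24); (0,6,1,18); (0,8,21,2); (0,9,17,6);
   (0,11,24,10); (0,12,22,17); (0,13,15,9); (0,16,5,3); (0,18,19,21); (0,20,12,23)]));
 (6, (1, 19, 1, [::
   (0,1,12,10); (0,2,22,1); (0,3,24,11); (0,4,1,19); (0,5,6,12); (0,7,9,24); (0,8,4,21);
   (0,9,20,13); (0,10,21,5); (0,11,5,22); (0,12,3,20); (0,13,11,7); (0,14,19,16); (0,16,2,23);
   (0,18,23,15)]));
 (7, (2, 9, 1, [::
   (0,1,13,19); (0,2,19,8); (0,3,10,17); (0,4,12,18); (0,5,7,23); (0,6,22,7); (0,8,18,5);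
   (0,10,23,2); (0,11,17,21); (0,12,16,22); (0,13,20,15); (0,14,24,3); (0,15,14,20); (0,16,3,24);
   (0,17,21,4)]));
 (2, (4, 6, 1, [::
   (0,1,23,8); (0,2,3,16); (0,3,17,14); (0,4,15,1); (0,5,25,4); (0,7,16,11); (0,8,10,25);
   (0,11,24,3); (0,14,5,24); (0,15,22,20); (0,16,11,7); (0,17,20,19)]));
 (1, (5, 5, 1, [::
   (0,1,7,18); (0,2,19,3); (0,3,16,14); (0,4,22,13); (0,6,2,24); (0,7,21,9); (0,8,25,21);
   (0,12,14,6); (0,14,13,25); (0,18,1,22); (0,19,17,16)]));
 (8, (2, 9, 1, [::
   (0,1,21,15); (0,2,16,25); (0,3,18,2); (0,4,23,16); (0,5,20,8); (0,6,17,20); (0,7,11,18);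
   (0,8,15,19); (0,10,22,17); (0,11,19,1); (0,12,6,23); (0,13,8,24); (0,14,25,12); (0,15,24,10);
   (0,16,13,22); (0,17,4,21)]));
 (7, (4, 5, 1, [::
   (0,1,23,3); (0,2,1,21); (0,3,22,9); (0,4,7,13); (0,7,16,24); (0,8,9,22); (0,9,2,26);
   (0,11,26,14); (0,12,8,23); (0,13,21,6); (0,14,20,18); (0,16,25,8); (0,17,24,16); (0,18,6,25);
   (0,19,17,20)]));
 (8, (4, 5, 1, [::
   (0,1,7,22); (0,2,22,9); (0,3,16,20); (0,4,20,1); (0,6,3,24); (0,7,8,23); (0,8,26,4);
   (0,9,25,17); (0,11,9,26); (0,12,27,6); (0,13,1,21); (0,14,24,13); (0,16,23,18); (0,17,6,27);
   (0,18,2,25); (0,19,21,8)]));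
 (1, (7, 4, 4, [::
   (0,1,27,18); (0,2,11,5); (0,3,26,25); (0,5,18,27); (0,6,17,11); (0,7,21,14); (0,9,19,22);
   (0,10,5,23); (0,11,9,10); (0,13,2,3); (0,14,7,28); (0,15,25,6); (0,17,22,19); (0,18,15,17);
   (0,19,6,9); (0,21,28,7); (0,22,23,13); (0,23,1,26); (0,25,3,2); (0,26,13,15); (0,27,10,1);
   (0,28,14,21); (1,0,11,26); (1,4,27,10); (1,6,19,4); (1,7,26,16); (1,8,28,22); (1,11,10,12);
   (1,12,18,7); (1,14,3,20); (1,15,22,28); (1,16,14,27); (1,18,23,0); (1,20,7,2); (1,24,6,11);
   (1,27,2,24); (1,28,15,8); (2,0,27,5); (2,8,11,21); (2,12,3,1); (2,13,15,12); (2,16,23,9);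
   (2,17,7,8); (2,23,28,16); (2,25,19,0); (3,10,28,17)]));
 (7, (2, 11, 1, [::
   (0,1,21,15); (0,2,23,4); (0,3,25,6); (0,4,3,8); (0,6,7,19); (0,7,22,13); (0,8,18,26);
   (0,9,14,23); (0,10,24,3); (0,13,28,18); (0,14,20,28); (0,15,6,24); (0,17,26,7); (0,18,13,27);
   (0,19,5,22); (0,20,10,25); (0,21,27,20)]));
 (2, (4, 7, 1, [::
   (0,1,16,10); (0,2,19,27); (0,3,28,23); (0,4,8,5); (0,5,4,3); (0,6,25,16); (0,9,5,25);
   (0,10,18,6); (0,11,27,17); (0,12,22,29); (0,13,15,2); (0,17,26,22); (0,23,29,8); (0,26,11,28)]));
 (0, (5, 6, 2, [::
   (0,1,21,26); (0,2,5,3); (0,3,29,16); (0,4,14,25); (0,5,20,27); (0,8,23,7); (0,9,19,11);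
   (0,10,26,21); (0,13,27,17); (0,14,15,28); (0,15,2,29); (0,16,8,1); (0,17,25,4); (0,19,11,10);
   (0,20,13,23); (0,21,7,2); (0,22,17,19); (0,26,3,22); (0,28,9,5); (0,29,1,9); (1,2,29,10);
   (1,4,23,27); (1,8,17,3); (1,16,21,14); (1,22,5,2)]));
 (8, (2, 11, 1, [::
   (0,1,4,8); (0,2,6,26); (0,3,2,27); (0,5,12,22); (0,6,22,10); (0,7,26,6); (0,8,5,14);
   (0,10,8,29); (0,12,21,24); (0,13,25,21); (0,14,9,23); (0,15,3,28); (0,16,7,25); (0,17,29,4);
   (0,18,27,20); (0,19,28,7); (0,20,23,17); (0,21,24,16)]));
 (7, (4, 6, 1, [::
   (0,1,3,26); (0,2,19,23); (0,3,27,8); (0,5,1,20); (0,7,15,24); (0,8,24,10); (0,9,14,30);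
   (0,10,29,17); (0,11,22,21); (0,13,26,5); (0,14,28,15); (0,15,4,29); (0,16,25,3); (0,17,16,25);
   (0,20,11,28); (0,21,7,27); (0,22,30,2)]));
 (1, (1, 33, 1, [::
   (0,1,3,13); (0,2,12,32); (0,3,17,5); (0,4,19,14); (0,5,1,9); (0,6,18,12); (0,7,25,8);
   (0,9,13,28); (0,11,33,22); (0,12,28,25); (0,13,7,30); (0,14,23,7); (0,18,2,26); (0,19,9,1);
   (0,22,11,33); (0,26,6,2); (0,31,4,3)]));
 (0, (5, 7, 1, [::
   (0,1,26,16); (0,2,31,8); (0,3,19,2); (0,4,8,17); (0,5,13,32); (0,6,1,11); (0,8,18,34);
   (0,11,24,23); (0,13,12,3); (0,15,30,18); (0,17,2,33); (0,20,29,24); (0,22,10,4); (0,24,15,13);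
   (0,27,32,29)]));
 (5, (1, 33, 1, [::
   (0,1,19,7); (0,2,1,24); (0,3,22,21); (0,4,8,5); (0,5,3,30); (0,6,36,11); (0,7,20,3);
   (0,8,24,33); (0,9,34,16); (0,10,21,19); (0,11,18,36); (0,12,6,25); (0,13,4,35); (0,14,10,28);
   (0,15,2,27); (0,17,7,34); (0,20,33,18); (0,22,37,32); (0,24,35,8); (0,26,28,23); (0,29,17,37)]));
 (5, (1, 41, 1, [::
   (0,1,17,31); (0,2,27,36); (0,3,32,21); (0,4,2,26); (0,5,45,14); (0,6,40,35); (0,7,6,44);
   (0,8,10,9); (0,10,23,41); (0,11,37,17); (0,12,8,42); (0,13,34,27); (0,15,22,10); (0,16,5,40);
   (0,17,43,32); (0,18,15,38); (0,19,11,43); (0,20,28,24); (0,22,44,19); (0,25,29,45);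
   (0,26,21,13); (0,27,38,29); (0,28,41,18); (0,31,25,23); (0,38,42,22)]))].

(** * Orders below 32 *)

Lemma direct_schedules_ok : all check_direct direct_schedules.
Proof. by vm_cast_no_check (erefl true). Qed.

Lemma CM_direct n k : (n, k) \in [seq (D.1.1.1, D.1.1.2) | D <- direct_schedules] -> CM n k.
Proof. by case/mapP => D /(allP direct_schedules_ok) /CM_of_check h [-> ->]. Qed.

Lemma complete_of_all n : all (fun k => good n k ==>
  ((n, k) \in [seq (D.1.1.1, D.1.1.2) | D <- direct_schedules])) (iota 0 n.+1) -> complete n.
Proof.
move=> /allP h k gk; apply: CM_direct; have := h k; rewrite gk; apply.
by rewrite mem_iota; case/andP: gk.
Qed.

Lemma complete_lt12 n : n < 12 -> complete n.
Proof.
have : all (fun n => all (fun k => good n k ==>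
  ((n, k) \in [seq (D.1.1.1, D.1.1.2) | D <- direct_schedules])) (iota 0 n.+1)) (iota 0 12).
  by vm_compute.
by move=> /allP h hn; apply/complete_of_all/h; rewrite mem_iota.
Qed.

Definition cyclic_holes (p : nat * frame_data) : seq nat := rcons (nseq p.2.1.1.2 p.2.1.1.1) p.1.

Lemma cyclic_frames_ok : all (fun p => check_frame (cyclic_holes p) p.2) cyclic_frames.
Proof. by vm_cast_no_check (erefl true). Qed.

Definition cyclic_reach := [seq (sumn (cyclic_holes p), reach (cyclic_holes p)) | p <- cyclic_frames].

Lemma CM_cyclic n k : has (fun r => (r.1 == n) && (k \in r.2)) cyclic_reach -> CM n k.
Proof.
have small : all (fun p => all (fun h => h < 12) (cyclic_holes p)) cyclic_frames by vm_compute.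
case/hasP => _ /mapP [p hp ->] /= /andP [/eqP <- hk]; apply: fill_list hk.
  exact: frame_of_check (allP cyclic_frames_ok p hp).
by move=> h hh; apply/complete_lt12/(allP (allP small p hp)).
Qed.

Definition tabulated n k :=
  ((n, k) \in [seq (D.1.1.1, D.1.1.2) | D <- direct_schedules]) ||
  has (fun r => (r.1 == n) && (k \in r.2)) cyclic_reach.

Lemma CM_tabulated n k : tabulated n k -> CM n k.
Proof. by case/orP; [apply: CM_direct | apply: CM_cyclic]. Qed.

Lemma tabulated_lt32 :
  all (fun n => all (fun k => good n k ==> tabulated n k) (iota 0 n.+1)) (iota 0 32).
Proof. by vm_cast_no_check (erefl true). Qed.

Lemma complete_lt32 n : n < 32 -> complete n.
Proof.
move=> hn k gk; apply: CM_tabulated; move: tabulated_lt32.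
move: tabulated => tab /allP h; have n_in : n \in iota 0 32 by rewrite mem_iota.
have k_in : k \in iota 0 n.+1 by rewrite mem_iota; case/andP: gk.
by have := allP (h n n_in) k k_in; rewrite gk.
Qed.

(** * Frames on the inflated blocks, and orders 32 to 110 *)

(** One base serves two lists of holes: a block whose point in the next to last group has weight 0
    and meets [g] groups of weight 2 before it, and a block with [g - 1] such groups and weight 2
    there as well. *)
Lemma weight_two_frames_ok : all (fun p =>
  let g := p.2.1.1.2 in
  check_frame (nseq g 2 ++ [:: 0; p.1]) p.2 && check_frame (nseq g.-1 2 ++ [:: 2; p.1]) p.2)
  weight_two_frames.
Proof. by vm_cast_no_check (erefl true). Qed.

Lemma weight_two_frame g v : 4 <= g <= 6 -> v <= 3 ->
  list_frame (nseq g 2 ++ [:: 0; v]) /\ list_frame (nseq g.-1 2 ++ [:: 2; v]).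
Proof.
move=> hg hv.
have : all (fun g => all (fun v => has (fun p => (p.1 == v) && (p.2.1.1.2 == g)) weight_two_frames)
  (iota 0 4)) (iota 4 3) by vm_compute.
move=> /allP chk; have g_in : g \in iota 4 3 by rewrite mem_iota; lia.
have v_in : v \in iota 0 4 by rewrite mem_iota.
have /hasP [p hp /andP [/eqP <- /eqP <-]] := allP (chk g g_in) v v_in.
by have /andP [/frame_of_check h1 /frame_of_check h2] := allP weight_two_frames_ok p hp.
Qed.

(** For [g = 3] a point of weight 0 would leave a block with only three holes of size 2, below the
    range of the table; this is why [t] must then be [m]. *)
Lemma inflated_frame g m t u :
  (exists B : 'I_m * 'I_m -> 'I_(g.+2) -> 'I_m, transversal_design B) ->
  3 <= g <= 5 -> (g == 3) ==> (t == m) -> t <= m -> u <= 3 * m ->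
  list_frame (nseq g (2 * m) ++ [:: 2 * t; u]).
Proof.
move=> hB hg g3 tm um; apply: inflate_list => // [v hv|lt v hv].
  by have [] := @weight_two_frame g.+1 v ltac:(lia) hv.
by have [] := @weight_two_frame g v ltac:(move: g3; lia) hv.
Qed.

(* (g, m, t, u) as in inflated_frame, giving order 2 m g + 2 t + u. *)
Definition inflation n : nat * nat * nat * nat :=
  if n <= 44 then (3, 4, 4, n - 32) else
  if n <= 55 then (4, 5, 0, n - 40) else
  if n <= 59 then (4, 5, 2, n - 44) else
  if n <= 63 then (4, 5, 4, n - 48) else
  if n <= 65 then (4, 5, 5, n - 50) else
  if n <= 67 then (4, 7, 0, n - 56) else
  if n <= 71 then (4, 7, 2, n - 60) else
  if n <= 85 then (4, 7, 4, n - 64) else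
  if n <= 87 then (4, 7, 5, n - 66) else
  if n <= 88 then (5, 7, 4, n - 78) else
  if n <= 99 then (5, 7, 4, n - 78) else
  if n <= 101 then (5, 7, 5, n - 80) else
  if n <= 103 then (4, 11, 2, n - 92) else (4, 11, 4, n - 96).

Definition inflation_holes n :=
  let: (g, m, t, u) := inflation n in nseq g (2 * m) ++ [:: 2 * t; u].

(** Lines over the field with four elements for [m = 4]. The other [m] are primes larger than every
    difference of two ordinary columns. *)
Lemma TD_inflation g m : (g, m) \in [:: (3, 4); (4, 5); (4, 7); (5, 7); (4, 11)] ->
  exists B : 'I_m * 'I_m -> 'I_(g.+2) -> 'I_m, transversal_design B.
Proof.
rewrite !inE => /or4P [/eqP [-> ->]|/eqP [-> ->]|/eqP [-> ->]|]; first exact: GF4_TD.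
- by apply: lines_TD => // -[|[|[|[|[]]]]].
- by apply: lines_TD => // -[|[|[|[|[]]]]].
case/orP=> /eqP [-> ->].
- by apply: lines_TD => // -[|[|[|[|[|[]]]]]].
- by apply: lines_TD => // -[|[|[|[|[]]]]].
Qed.

Definition reaches_good hs n :=
  let r := reach hs in all (fun k => good n k ==> (k \in r) || tabulated n k) (iota 0 n.+1).

Lemma reaches_goodP hs n k : reaches_good hs n -> good n k -> k \in reach hs \/ tabulated n k.
Proof.
move=> chk gk; have k_in : k \in iota 0 n.+1 by rewrite mem_iota; case/andP: gk.
by move: chk; rewrite /reaches_good; move: tabulated => tab /allP /(_ k k_in); rewrite gk => /orP.
Qed.

Definition inflation_ok n :=
  let: (g, m, t, u) := inflation n in
  [&& (g, m) \in [:: (3, 4); (4, 5); (4, 7); (5, 7); (4, 11)], (g == 3) ==> (t == m),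
      t <= m, u <= 3 * m & all (fun h => h < 32) (inflation_holes n)] &&
  ((sumn (inflation_holes n) == n) && reaches_good (inflation_holes n) n).

Lemma inflation_ok_lt111 : all inflation_ok (iota 32 79).
Proof. by vm_cast_no_check (erefl true). Qed.

Lemma complete_lt111 n : 32 <= n < 111 -> complete n.
Proof.
move=> hn k gk; have n_in : n \in iota 32 79 by rewrite mem_iota; lia.
have := allP inflation_ok_lt111 n n_in; rewrite /inflation_ok /inflation_holes.
case: (inflation n) => -[[g m] t] u.
case/andP => /and5P [gm g3 tm um hs] /andP [/eqP e hr].
have [hk|] := reaches_goodP hr gk; last exact: CM_tabulated.
rewrite -[n in CM n _]e; apply: fill_list hk.
  apply: inflated_frame => //; first exact: TD_inflation.
  by move: gm; rewrite !inE -!pair_eqE /pair_eq /=; lia.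
by move=> h hh; apply/complete_lt32/(allP hs).
Qed.

(** * Large orders by strong induction *)

Lemma good_large n k : 25 < n -> k <= n -> ~~ odd (n - k) -> good n k.
Proof.
move=> hn kn od; rewrite /good kn od /=.
have N : all (fun p => p.1 <= 25) (definite_exceptions ++ possible_exceptions) by vm_compute.
have nin p : p \in definite_exceptions ++ possible_exceptions -> p.1 <= 25 by move/(allP N).
by rewrite -negb_or -mem_cat; apply/negP => /nin /=; lia.
Qed.

(** Every exceptional pair has order at most 6 or a spouse count strictly between 1 and the order,
    so the two extreme counts are always available for larger orders. *)
Lemma good_ends n k : 6 < n -> (k == n) || (k == odd n) -> good n k.
Proof.
move=> hn hk; rewrite /good.
have N : all (fun p => (p.1 <= 6) || (1 < p.2 < p.1)) (definite_exceptions ++ possible_exceptions).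
  by vm_compute.
have nin p : p \in definite_exceptions ++ possible_exceptions -> (p.1 <= 6) || (1 < p.2 < p.1).
  by move/(allP N).
have kn : k <= n by case/orP: hk => /eqP -> //; case: (odd n); lia.
rewrite kn andTb oddB // -negb_or -mem_cat; apply/andP; split.
  by case/orP: hk => /eqP ->; [rewrite addbb | case: (odd n)].
apply/negP => /nin /=; case/orP: hk => /eqP ->; first by lia.
by case: (odd n); lia.
Qed.

Lemma complete_all n : complete n.
Proof.
have [N hN] := ubnP n; elim: N n hN => // N IH n hN k gk.
have [lt|ge] := ltnP n 111.
  have [lt'|ge'] := ltnP n 32; first exact: complete_lt32.
  by apply: complete_lt111 => //; rewrite ge' lt.
(* The four large holes have [2 * m >= 26] players, beyond all exceptions, and the last hole has [u]
   with [7 <= u <= 3 * m]. The bound 111 is [8 * 13 + 7]. In each range of the residue of [n - 7]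
   modulo 48 one of [6 * q - 1], [6 * q + 1], [6 * q + 5] fits. *)
have [m [m13 um lm m2 m3]] : exists m, [/\ 13 <= m, 8 * m + 7 <= n, n <= 11 * m, m %% 2 = 1 & m %% 3 != 0].
  have [q [r [eq rlt]]] : exists q r, n = 48 * q + r + 7 /\ r < 48.
    exists ((n - 7) %/ 48), ((n - 7) %% 48); split; last by rewrite ltn_mod.
    by have := divn_eq (n - 7) 48; lia.
  have [h|h] := ltnP r 8; first by exists (6 * q - 1); split; lia.
  have [h'|h'] := ltnP r 40; first by exists (6 * q + 1); split; lia.
  by exists (6 * q + 5); split; lia.
pose u := n - 8 * m.
have hB : exists B : 'I_m * 'I_m -> 'I_5 -> 'I_m, transversal_design B.
  apply: lines_TD => [|d]; first by lia.
  have c2 : coprime 2 m by rewrite prime_coprime // /dvdn m2.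
  have c3 : coprime 3 m by rewrite prime_coprime // /dvdn.
  by case: d => [|[|[|[|d]]]] //; rewrite coprime1n.
have hf : list_frame (nseq 3 (2 * m) ++ [:: 2 * m; u]) by apply: inflated_frame => //; rewrite /u; lia.
have en : sumn (nseq 3 (2 * m) ++ [:: 2 * m; u]) = n by rewrite /= /u; lia.
case/and4P: (gk) => kn od _ _.
(* The order [u] may have exceptions, so its hole receives an extreme count only: all [u] pairs if
   [k] allows it, otherwise the least count of the right parity. The even remainder is split
   greedily over the four large holes into even parts of at most [2 * m]. *)
pose ku := if k < u then (odd n : nat) else u.
pose part j := minn (2 * m) (k - ku - j * (2 * m)).
pose ks j := if j < 4 then part j else ku.
have odd_k : odd k = odd n by apply/eqP; move: od; rewrite oddB //; case: (odd n); case: (odd k).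
have odd_u : odd u = odd n by rewrite /u oddB ?oddM ?addbF //; lia.
have ku_le : ku <= k.
  by rewrite /ku; case: ltnP => // _; case: (boolP (odd n)) odd_k => // _; case: (k).
have rest_even : ~~ odd (k - ku).
  by rewrite oddB // odd_k /ku; case: ifP => _; [case: (odd n) | rewrite odd_u addbb].
have rest_le : k - ku <= 8 * m by rewrite /ku /u; case: ifP; lia.
have ek : k = \sum_(j < size (nseq 3 (2 * m) ++ [:: 2 * m; u])) ks j.
  rewrite /= big_ord_recr /= (eq_bigr (fun j : 'I_4 => part j)) => [|j _].
    by rewrite sum_minn ?subnK //; move: rest_le; lia.
  by rewrite /ks ltn_ord.
rewrite -[n in CM n _]en [k in CM _ k]ek; apply: fill_values => // j /= hj.
have [j4|j4] := ltnP j 4.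
  have -> : nth 0 [:: 2 * m, 2 * m, 2 * m, 2 * m, u & [::]] j = 2 * m.
    by case: j j4 {hj} => [|[|[|[|]]]].
  rewrite /ks j4; apply: IH; first by move: hN; lia.
  have part_even : ~~ odd (part j).
    rewrite /part /minn; case: ifP => _; first by rewrite oddM.
    have [le|lt] := leqP (j * (2 * m)) (k - ku).
      by rewrite oddB // !oddM andbF addbF.
    by have -> : k - ku - j * (2 * m) = 0 by apply/eqP; rewrite subn_eq0 ltnW.
  have part_le : part j <= 2 * m by apply: geq_minl.
  apply: good_large => //; first by lia.
  by rewrite oddB // (negbTE part_even) addbF mul2n odd_double.
have -> : j = 4 by lia.
rewrite /ks /=; apply: IH; first by rewrite /u; move: hN; lia.
apply: good_ends; first by rewrite /u; lia.
by rewrite /ku /u; case: ifP => _; [apply/orP; right; apply/eqP; congr nat_of_bool; lia | rewrite eqxx].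
Qed.

Theorem theorem5 :
  (forall n k : nat, 2 <= n -> k <= n -> ~~ odd (n - k) ->
     (n, k) \notin definite_exceptions ->
     (n, k) \notin possible_exceptions ->
     CMDRR_exists n k) /\
  (forall n k : nat, (n, k) \in definite_exceptions -> ~ CMDRR_exists n k).
Proof.
split=> [n k _ kn od h1 h2|]; last exact: no_CMDRR.
by apply/CMDRR_of_CM/complete_all; rewrite /good kn od h1 h2.
Qed.
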